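(* Let $f$ be a probability density on $\mathbb R^D$ (w.r.t. Lebesgue measure) with $\|f\|_\infty\le f_{\max}<\infty$, and let $K$ be a kernel satisfying the kernel assumption below. For every $\delta\in(0,1)$ there are constants $C_\delta>0$, $h_0>0$ and $n_0$, depending only on the VC characteristics $(A,v)$ of $K$, $\|K\|_\infty$, $\|K\|_2$, $f_{\max}$ and $\delta$, such that the following holds. Let $\sigma\in(0,h_0]$, $\epsilon\in(0,1)$, $\lambda>0$, and let $n\ge n_0$ with $$n\ge\frac{C_\delta}{\sigma^D\lambda^2\epsilon^2}\log\Big(\frac1\sigma\Big).$$ Let $X_1,\dots,X_n$ be i.i.d. with density $f$ and $\hat f_\sigma(x)=\frac{1}{n\sigma^D}\sum_{i=1}^nK\big(\frac{x-X_i}{\sigma}\big)$. Then with probability at least $1-\delta$, for every pair $A,A'\subseteq\mathbb R^D$ of full-dimensional $(\sigma,\epsilon)$-separated clusters at level $\lambda$, both $A$ and $A'$ are contained in $L:=\{x\in\mathbb R^D:\hat f_\sigma(x)\ge\lambda(1-\epsilon/2)\}$, and $A$ and $A'$ lie in different connected components of $L$.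
   Context: Kernel assumption: $K:\mathbb R^D\to[0,\infty)$ is bounded, $\{x:K(x)>0\}\subseteq B(0,1)$ (closed Euclidean unit ball), $\int_{\mathbb R^D}K=1$, and the class $\mathcal F=\{K((x-\cdot)/h):x\in\mathbb R^D,h>0\}$ satisfies, for some constants $A,v>0$ (the VC characteristics of $K$), $\sup_Q\mathcal N(\mathcal F,L_2(Q),\eta\|F\|_{L_2(Q)})\le(A/\eta)^v$ for all $\eta\in(0,1)$, where $\mathcal N(T,\mathrm{d},\eta)$ is the $\eta$-covering number, $F$ is the envelope of $\mathcal F$, and the supremum is over all probability measures $Q$ on $\mathbb R^D$. Full-dimensional separated clusters: for $\sigma>0$, $\epsilon\in(0,1)$, $\lambda>0$, two path-connected sets $A,A'\subseteq\mathbb R^D$ are $(\sigma,\epsilon)$-separated clusters at level $\lambda$ if $f\ge\lambda$ on $A_\sigma\cup A'_\sigma$ and there is a nonempty $S\subseteq\mathbb R^D$ such that every continuous path in $\mathbb R^D$ from a point of $A$ to a point of $A'$ meets $S$ and $\sup_{S_\sigma}f<(1-\epsilon)\lambda$; here $Z_\sigma=Z+B(0,\sigma)$. *)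

(* Defs.v *)
From HB Require Import structures.
From mathcomp Require Import all_boot all_order all_algebra.
From mathcomp Require Import all_classical all_reals all_analysis.
Set Implicit Arguments. Unset Strict Implicit. Unset Printing Implicit Defensive.
Import Order.TTheory GRing.Theory Num.Theory.
Import numFieldNormedType.Exports.
Local Open Scope classical_set_scope.
Local Open Scope ring_scope.

(* Points of R^D are row vectors 'rV[R]_D (topology = product topology,
   i.e. the Euclidean topology). *)

Notation borelRD R D := (g_sigma_algebraType (@open 'rV[R]_D)).

Definition enorm {R : realType} {D : nat} (x : 'rV[R]_D) : R :=
  Num.sqrt (\sum_(i < D) x ord0 i ^+ 2).

Definition fatten {R : realType} {D : nat} (Z : set 'rV[R]_D) (s : R) :
  set 'rV[R]_D := [set x | exists2 z, Z z & enorm (x - z) <= s].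

(* Lebesgue integral on R^D of a nonnegative (Borel) function, computed as the
   iterated one-dimensional Lebesgue integral (Tonelli). *)
Fixpoint iint {R : realType} (n : nat) : ('rV[R]_n -> \bar R) -> \bar R :=
  match n return ('rV[R]_n -> \bar R) -> \bar R with
  | 0 => fun g => g 0
  | m.+1 => fun g =>
      (\int[@lebesgue_measure R]_t
         iint (fun y : 'rV[R]_m => g (row_mx (const_mx t : 'rV[R]_1) y)))%E
  end.

Definition prob_density {R : realType} {D : nat} (f : 'rV[R]_D -> R) : Prop :=
  [/\ measurable_fun setT (f : borelRD R D -> R),
      (forall x, 0 <= f x) &
      iint (fun x => (f x)%:E) = 1%E].

Definition iid_with_density {R : realType} {D : nat} {d : measure_display}
  {Omega : measurableType d} (P : probability Omega R) (n : nat)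
  (X : 'I_n -> Omega -> 'rV[R]_D) (f : 'rV[R]_D -> R) : Prop :=
  (forall i, measurable_fun setT (X i : Omega -> borelRD R D)) /\
  (forall B : 'I_n -> set (borelRD R D), (forall i, measurable (B i)) ->
     P (\bigcap_i (X i @^-1` B i)) =
     (\big[*%E/1%E]_(i < n) iint (fun x => (f x)%:E * (\1_(B i) x)%:E))%E).

Definition kernel_class {R : realType} {D : nat} (K : 'rV[R]_D -> R) :
  set ('rV[R]_D -> R) :=
  [set g | exists x h, 0 < h /\ g = (fun y => K (h^-1 *: (x - y)))].

Definition kernel_envelope {R : realType} {D : nat} (K : 'rV[R]_D -> R)
  (y : 'rV[R]_D) : R :=
  sup [set r | exists x h, 0 < h /\ r = K (h^-1 *: (x - y))].

Definition covering_number_le {R : realType} {D : nat}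
  (Q : probability (borelRD R D) R) (F : set ('rV[R]_D -> R))
  (env : 'rV[R]_D -> R) (eta b : R) : Prop :=
  exists m : nat, exists c : 'I_m -> ('rV[R]_D -> R),
    m%:R <= b /\
    (forall j, measurable_fun setT (c j : borelRD R D -> R)) /\
    (forall g, F g -> exists j,
       (\int[Q]_y ((g y - c j y) ^+ 2)%:E <=
        (eta ^+ 2)%:E * \int[Q]_y ((env y) ^+ 2)%:E)%E).

Definition kernel_assumption {R : realType} {D : nat} (K : 'rV[R]_D -> R)
  (A v : R) : Prop :=
  [/\ measurable_fun setT (K : borelRD R D -> R),
      (forall x, 0 <= K x) /\ (exists M, forall x, K x <= M),
      (forall x, 0 < K x -> enorm x <= 1),
      iint (fun x => (K x)%:E) = 1%E /\ (0 < A /\ 0 < v) &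
      forall (Q : probability (borelRD R D) R) (eta : R), 0 < eta < 1 ->
        covering_number_le Q (kernel_class K) (kernel_envelope K) eta
          ((A / eta) `^ v)].

Definition is_path {R : realType} {D : nat} (g : R -> 'rV[R]_D)
  (a b : 'rV[R]_D) : Prop :=
  {within `[0, 1]%classic, continuous g} /\ g 0 = a /\ g 1 = b.

Definition path_connected {R : realType} {D : nat} (A : set 'rV[R]_D) : Prop :=
  forall a b, A a -> A b -> exists g, is_path g a b /\
    (forall t, 0 <= t <= 1 -> A (g t)).

Definition separated_clusters {R : realType} {D : nat} (f : 'rV[R]_D -> R)
  (sigma eps lambda : R) (A A' : set 'rV[R]_D) : Prop :=
  [/\ path_connected A, path_connected A',
      (forall x, (fatten A sigma `|` fatten A' sigma) x -> lambda <= f x) &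
      exists S : set 'rV[R]_D, [/\ S !=set0,
        (forall g a a', A a -> A' a' -> is_path g a a' ->
           exists2 t, 0 <= t <= 1 & S (g t)) &
        sup (f @` fatten S sigma) < (1 - eps) * lambda]].

Definition kde {R : realType} {D : nat} (K : 'rV[R]_D -> R) (sigma : R)
  (n : nat) (Xs : 'I_n -> 'rV[R]_D) (x : 'rV[R]_D) : R :=
  (n%:R * sigma ^+ D)^-1 * \sum_(i < n) K (sigma^-1 *: (x - Xs i)).

(* Main.v *)
Require Import Defs.
From HB Require Import structures.
From mathcomp Require Import all_boot all_order all_algebra.
From mathcomp Require Import all_classical all_reals all_analysis.
From mathcomp Require Import measurable_realfun ring lra.
Import Order.TTheory GRing.Theory Num.Theory.
Import numFieldNormedType.Exports.
Local Open Scope classical_set_scope.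
Local Open Scope ring_scope.

(** With g_x(y) = K((x - y) / sigma) and mu the common law of the X_i, everything
    reduces to showing that, with probability 1 - delta,
    |sum_i g_x(X_i) - n mu(g_x)| < n sigma^D lambda epsilon / 2 for all x.

    Symmetrization with a ghost sample X' gives, for
    h = sup_x |sum_i (g_x(X_i) - g_x(X'_i))|, a law that is invariant under
    exchanging X_i and X'_i, so that h may be replaced by its average over random
    signs.  Chaining over the covers provided by the entropy hypothesis at the
    empirical measure of the 2n points, started at the deterministic scale
    sigma^(D+1), bounds this average by a multiple of
    kappa log(1/sigma) + (V + n sigma^D) / kappa, where
    V <= ||K|| sup_x sum_i (g_x(X_i) + g_x(X'_i)) is itself at most
    2 n mu(g_x) plus the deviations: the inequality closes on E h, and Markov's
    inequality concludes because the constants may depend on delta.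

    The supremum runs over uncountably many translates of a merely Borel kernel.
    It is measurable for the completion of any finite measure by the measurable
    projection theorem, obtained here from Suslin schemes and measurable hulls.

    For the topology, kde < lambda (1 - epsilon/2) holds not only on S but on its
    closure, since spheres are null.  Hence the level set lies in the open
    complement of that closure, where connected sets are joined by paths. *)

Set Implicit Arguments. Unset Strict Implicit. Unset Printing Implicit Defensive.

(** * Suslin sets are measurable up to null sets *)

Section suslin.
Context d (T : measurableType d) (R : realType).
Variable mu : {finite_measure set T -> \bar R}.

(** The infimum of [mu] over measurable supersets is attained by a countable intersection of
    near-minimizers. Cutting this intersection by another superset [M] cannot lower its mass, so [H]
    exceeds [M] only by a null set. *)
Lemma measurable_hull (A : set T) : exists H, [/\ measurable H, A `<=` H &
  forall M, measurable M -> A `<=` M -> mu (H `\` M) = 0%E].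
Proof.
pose S := [set mu M | M in [set M | measurable M /\ A `<=` M]].
have finmu M : measurable M -> mu M \is a fin_num by exact: fin_num_measure.
have Sfin : ereal_inf S \is a fin_num.
  rewrite fin_numE; apply/andP; split.
    rewrite gt_eqF// (lt_le_trans (ltNy0 : (_ < 0)%E))//.
    by apply: le_ereal_inf_tmp => _ [M _ <-]; exact: measure_ge0.
  rewrite lt_eqF//; apply: (@le_lt_trans _ _ (mu setT)).
    by apply: ereal_inf_lbound; exists setT.
  by rewrite ltey_eq finmu.
have /choice[M_ M_P] : forall k : nat, exists M, [/\ measurable M, A `<=` M &
    (mu M < ereal_inf S + (k.+1%:R^-1)%:E)%E].
  move=> k; have [|_ [M [mM AM] <-] lt] := @lb_ereal_inf_adherent _ S k.+1%:R^-1 _ Sfin.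
    by rewrite invr_gt0.
  by exists M.
exists (\bigcap_k M_ k); split.
- by apply: bigcapT_measurable => k; case: (M_P k).
- by move=> w Aw k _; case: (M_P k) => _ + _; apply.
move=> M mM AM.
have mH : measurable (\bigcap_k M_ k).
  by apply: bigcapT_measurable => k; case: (M_P k).
have HM : (ereal_inf S <= mu ((\bigcap_k M_ k) `&` M))%E.
  apply: ereal_inf_lbound; exists ((\bigcap_k M_ k) `&` M) => //; split.
    exact: measurableI.
  by move=> w Aw; split; [move=> k _; case: (M_P k) => _ + _; apply|exact: AM].
have Hinf : (mu (\bigcap_k M_ k) <= ereal_inf S)%E.
  apply/lee_addgt0Pr => e e0.
  have [k ke] : exists k : nat, k.+1%:R^-1 < e.
    have := near_infty_natSinv_lt (PosNum e0); move=> [N _ /(_ N (leqnn N))] ?.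
    by exists N.
  apply: (@le_trans _ _ (mu (M_ k))).
    apply: le_measure; rewrite ?inE//; first by case: (M_P k).
    exact: bigcap_inf.
  case: (M_P k) => _ _ /ltW/le_trans; apply; apply: leeD2l.
  by rewrite lee_fin ltW.
rewrite measureD//; last by rewrite ltey_eq finmu.
apply/eqP; rewrite eq_le; apply/andP; split.
  by rewrite lee_subel_addr ?add0e ?(le_trans Hinf)// finmu//; exact: measurableI.
rewrite sube_ge0 ?finmu ?orbT//; last exact: measurableI.
by apply: le_measure; rewrite ?inE//; exact: measurableI.
Qed.

(** A Suslin scheme is indexed by finite sequences; here it is encoded by infinite ones of which
    [C k] reads only a prefix. *)
Definition nonanticipating (U : Type) (C : nat -> (nat -> nat) -> U) :=
  forall k a b, (forall i, (i < k)%N -> a i = b i) -> C k a = C k b.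

(* A set that is squeezed between two measurable sets differing by a null set
   is measurable for the completion of [mu]. *)
Definition null_sandwich (A : set T) := exists A0 A1,
  [/\ measurable A0, measurable A1, A0 `<=` A, A `<=` A1 & mu (A1 `\` A0) = 0%E].

Lemma null_sandwich_bigcup (A : nat -> set T) :
  (forall k, null_sandwich (A k)) -> null_sandwich (\bigcup_k A k).
Proof.
move=> /choice[A0] /choice[A1 P].
exists (\bigcup_k A0 k), (\bigcup_k A1 k); split.
- by apply: bigcupT_measurable => k; case: (P k).
- by apply: bigcupT_measurable => k; case: (P k).
- by apply: subset_bigcup => k _; case: (P k).
- by apply: subset_bigcup => k _; case: (P k).
apply/eqP; rewrite eq_le measure_ge0 andbT.
have [|N [mN N0]] := @negligible_bigcup _ _ _ mu (fun k => A1 k `\` A0 k).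
  by move=> k; exists (A1 k `\` A0 k); case: (P k) => ? ? ? ? ?; split => //; exact: measurableD.
move=> sN; rewrite -N0; apply: le_measure; rewrite ?inE//.
  by apply: measurableD; apply: bigcupT_measurable => k; case: (P k).
move=> w [[k _ A1w] nA0]; apply: sN; exists k => //; split => //.
by move=> A0w; apply: nA0; exists k.
Qed.

Lemma nth_rcons_lt (s : seq nat) x i : (i < size s)%N -> nth 0%N (rcons s x) i = nth 0%N s i.
Proof. by move=> ?; rewrite nth_rcons ifT. Qed.

(* Marczewski: if [H s] is a measurable hull of the part of the set reached from
   the prefix [s], then [H s] is covered by the [H (rcons s i)] up to a null set,
   so that almost every point of [H [::]] follows an infinite branch. *)
Lemma suslin_null_sandwich (C : nat -> (nat -> nat) -> set T) :
  (forall k a, measurable (C k a)) -> nonanticipating C ->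
  null_sandwich [set w | exists a, forall k, C k a w].
Proof.
move=> mC lC.
pose A_ (s : seq nat) := [set w | exists a, (forall i, (i < size s)%N -> a i = nth 0%N s i) /\
  forall k, C k a w].
have /choice[H HP] := fun s => measurable_hull (A_ s).
(* The constraints [C k] with [k <= size s] are already decided by the prefix [s]. *)
pose G s := H s `&` \bigcap_(k in [set k | (k <= size s)%N]) C k (nth 0%N s).
have mG s : measurable (G s).
  apply: measurableI; first by case: (HP s).
  by apply: bigcap_measurable => //; exists 0%N.
have AG s : A_ s `<=` G s.
  move=> w Asw; split; first by case: (HP s) => _ + _; apply.
  move=> k /= ks; case: Asw => a [as_ aC].
  rewrite -(lC k a) => // i ik; apply: as_; exact: leq_trans ks.
(* Points of [G s] that no one-letter extension of [s] retains; the union of the children contains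
   [A_ s], so the hull property makes them null. *)
pose N s := G s `\` \bigcup_i G (rcons s i).
have mN s : measurable (N s) by apply: measurableD => //; exact: bigcupT_measurable.
have N0 s : mu (N s) = 0%E.
  case: (HP s) => mH AH /(_ (\bigcup_i G (rcons s i))) H0.
  apply/eqP; rewrite eq_le measure_ge0 andbT -H0; last 2 first.
    exact: bigcupT_measurable.
    move=> w [a [as_ aC]]; exists (a (size s)) => //; apply: AG; exists a; split => //.
    move=> i; rewrite size_rcons ltnS leq_eqVlt => /orP[/eqP->|is_].
      by rewrite nth_rcons ltnn eqxx.
    by rewrite nth_rcons_lt// as_.
  apply: le_measure; rewrite ?inE//.
    by apply: measurableD => //; exact: bigcupT_measurable.
  by apply: setSD; exact: subIsetl.
(* There are countably many finite sequences, so a single null set collects all the dead ends. *)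
pose NN := \bigcup_n (if unpickle n is Some s then N s else set0).
have mNN : measurable NN by apply: bigcupT_measurable => n; case: unpickle.
have NN0 : mu NN = 0%E.
  apply/eqP; rewrite eq_le measure_ge0 andbT.
  have [|M [mM M0 sM]] := @negligible_bigcup _ _ _ mu
      (fun n => if unpickle n is Some s then N s else set0).
    move=> n; exists (if unpickle n is Some s then N s else set0).
    by case: (unpickle n) => [s|]; split; [exact: mN|exact: N0|exact: subset_refl |exact: measurable0|exact: measure0|exact: subset_refl].
  by rewrite -M0; apply: le_measure; rewrite ?inE.
exists (G [::] `\` NN), (G [::]); split => //.
- exact: measurableD.
- move=> w [G0w NNw].
  have /choice[f fP] : forall s, exists i, G s w -> G (rcons s i) w.
    move=> s; have [Gsw|] := pselect (G s w); last by exists 0%N.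
    apply: contrapT => nex; apply: NNw; exists (pickle s) => //.
    rewrite pickleK; split => // -[i _ Giw]; apply: nex; by exists i.
  (* Off [NN] every prefix can be extended, and iterating the choice yields the infinite branch. *)
  pose s := fix s k := if k is k'.+1 then rcons (s k') (f (s k')) else [::].
  have sz k : size (s k) = k by elim: k => //= k IH; rewrite size_rcons IH.
  have nths k i : (i < k)%N -> nth 0%N (s k) i = f (s i).
    elim: k => // k IH; rewrite ltnS leq_eqVlt => /orP[/eqP->|ik] /=.
      by rewrite nth_rcons sz ltnn eqxx.
    by rewrite nth_rcons_lt ?sz// IH.
  have Gs k : G (s k) w by elim: k => //= k IH; exact: fP.
  exists (fun k => f (s k)) => k.
  have [_ /(_ k)] := Gs k; rewrite /= sz => /(_ (leqnn _)).
  by rewrite (lC k (nth 0%N (s k)) (fun k => f (s k))) => [|i]; [apply|exact: nths].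
- by move=> w [a aC]; apply: AG; exists a; split => // k; exact: aC.
- apply/eqP; rewrite eq_le measure_ge0 andbT -NN0; apply: le_measure; rewrite ?inE//.
    by apply: measurableD => //; exact: measurableD.
  by move=> w [Gw nGw]; apply: contrapT => NNw; apply: nGw.
Qed.

End suslin.

(** * Measurable projection *)

Section projection.
Context d (T : measurableType d) (Y : ptopologicalType).

(** Suslin's operation on rectangles. The closed and the measurable sides are kept as separate
    schemes because projection treats the first by compactness and keeps the second. *)
Definition analytic_set (B : set (Y * T)) :=
  exists (G : nat -> (nat -> nat) -> set Y) (A : nat -> (nat -> nat) -> set T),
  [/\ forall k a, closed (G k a), forall k a, measurable (A k a),
      nonanticipating G, nonanticipating A &
      forall p, B p <-> exists a, forall k, G k a p.1 /\ A k a p.2].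

Lemma analytic_setX (F : set Y) (A : set T) : closed F -> measurable A ->
  analytic_set (F `*` A).
Proof.
move=> cF mA; exists (fun _ _ => F), (fun _ _ => A); split => // p.
by split=> [[? ?]|[_ /(_ 0%N)//]]; exists (fun=> 0%N).
Qed.

(** The first entry of the sequence selects the index [m], the remaining ones form a branch for
    [B m]; level 0 reads nothing and imposes nothing. *)
Lemma analytic_bigcup (B : nat -> set (Y * T)) : (forall m, analytic_set (B m)) ->
  analytic_set (\bigcup_m B m).
Proof.
move=> /choice[G] /choice[A P].
exists (fun k a => if k is k'.+1 then G (a 0%N) k' (fun i => a i.+1) else setT),
  (fun k a => if k is k'.+1 then A (a 0%N) k' (fun i => a i.+1) else setT); split.
- by move=> [|k] a; [exact: closedT|case: (P (a 0%N))].
- by move=> [|k] a; [exact: measurableT|case: (P (a 0%N))].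
- move=> [|k] a b ab //; rewrite (ab 0%N)//; case: (P (b 0%N)) => _ _ + _ _.
  by apply=> i ik; exact: ab.
- move=> [|k] a b ab //; rewrite (ab 0%N)//; case: (P (b 0%N)) => _ _ _ + _.
  by apply=> i ik; exact: ab.
move=> p; split.
  move=> [m _]; case: (P m) => _ _ _ _ -> [a aP].
  by exists (fun k => if k is k'.+1 then a k' else m) => -[|k]//=; exact: aP.
move=> [a aP]; exists (a 0%N) => //; case: (P (a 0%N)) => _ _ _ _ ->.
by exists (fun i => a i.+1) => k; exact: (aP k.+1).
Qed.

(** A single sequence codes one branch for each [m] through the pairing [c]. *)
Lemma analytic_bigcap (B : nat -> set (Y * T)) : (forall m, analytic_set (B m)) ->
  analytic_set (\bigcap_m B m).
Proof.
move=> /choice[G] /choice[A P].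
pose c (m i : nat) : nat := pickle (m, i).
(* The prefix lengths [j] of the [m]-th branch that can be read off the first [k] entries;
   restricting to them keeps the new scheme nonanticipating. *)
pose D k m := [set j | forall i, (i < j)%N -> (c m i < k)%N].
exists (fun k a => \bigcap_m \bigcap_(j in D k m) G m j (fun i => a (c m i))),
  (fun k a => \bigcap_m \bigcap_(j in D k m) A m j (fun i => a (c m i))); split.
- by move=> k a; apply: closed_bigI => m _; apply: closed_bigI => j _; case: (P m).
- move=> k a; apply: bigcapT_measurable => m; apply: bigcap_measurable; first by exists 0%N.
  by move=> j _; case: (P m).
- move=> k a b ab; apply: eq_bigcapr => m _; apply: eq_bigcapr => j Dj.
  by case: (P m) => _ _ + _ _; apply => i ij; apply: ab; exact: Dj.
- move=> k a b ab; apply: eq_bigcapr => m _; apply: eq_bigcapr => j Dj.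
  by case: (P m) => _ _ _ + _; apply => i ij; apply: ab; exact: Dj.
move=> p; split.
  move=> Bp; have /choice[a aP] : forall m, exists a, forall k, G m k a p.1 /\ A m k a p.2.
    by move=> m; have := Bp m I; case: (P m) => _ _ _ _ ->.
  exists (fun n => if unpickle n is Some mi then a mi.1 mi.2 else 0%N) => k.
  have E m : (fun i => if unpickle (c m i) is Some mi then a mi.1 mi.2 else 0%N) = a m.
    by apply/funext => i; rewrite pickleK.
  by split=> m _ j Dj; rewrite E; case: (aP m j).
move=> [a aP] m _; case: (P m) => _ _ _ _ ->; exists (fun i => a (c m i)) => j.
have [k kP] : exists k, D k m j.
  exists (\sum_(i < j) (c m i).+1)%N => i ij.
  by rewrite (bigD1 (Ordinal ij))//= ltn_addr.
by have [/(_ m I j kP) ? /(_ m I j kP)] := aP k.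
Qed.

Hypothesis open_Fsigma : forall U : set Y, open U ->
  exists2 F : nat -> set Y, (forall n, closed (F n)) & U = \bigcup_n F n.

Local Notation YB := (g_sigma_algebraType (@open Y)).

(** Analytic sets are not closed under complement, but those whose complement is also analytic form
    a sigma-algebra. It contains the generating cylinders; for open sets of [Y] this is where
    [open_Fsigma] enters. *)
Lemma measurable_analytic (B : set (YB * T)) : measurable B -> analytic_set B.
Proof.
suff : measurable `<=` [set B : set (YB * T) | analytic_set B /\ analytic_set (~` B)].
  by move=> sub /sub[].
have sC : forall B : set (YB * T), analytic_set B /\ analytic_set (~` B) ->
    analytic_set (~` B) /\ analytic_set (~` ~` B).
  by move=> C [? ?]; rewrite setCK.
have sU : forall F : nat -> set (YB * T), (forall n, analytic_set (F n) /\ analytic_set (~` (F n))) ->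
    analytic_set (\bigcup_k F k) /\ analytic_set (~` (\bigcup_k F k)).
  move=> F FP; split; first by apply: analytic_bigcup => n; case: (FP n).
  by rewrite setC_bigcup; apply: analytic_bigcap => n; case: (FP n).
have s0 : analytic_set (set0 : set (YB * T)) /\ analytic_set (~` (set0 : set (YB * T))).
  rewrite setC0 -setXTT -{1}(@setX0 Y T setT).
  by split; apply: analytic_setX => //; exact: closedT.
apply: smallest_sub.
  by split => //= A; rewrite setTD => /sC.
rewrite subUset; split.
- move=> _ [A mA <-]; rewrite setTI.
  suff : @measurable _ YB `<=` [set A | analytic_set (A `*` [set: T]) /\ analytic_set (~` (A `*` [set: T]))].
    by move=> /(_ A mA); rewrite /= setXT.
  apply: smallest_sub.
    split => /=; first by rewrite set0X.
    - by move=> C; rewrite setTD !setXT -[fst @^-1` ~` C]/(~` (fst @^-1` C)) => /sC.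
    - by move=> F FP; rewrite setXT preimage_bigcup; apply: sU => n; rewrite -setXT.
  move=> U oU /=; split.
    have [F cF ->] := open_Fsigma oU.
    rewrite setXT preimage_bigcup; apply: analytic_bigcup => n.
    by rewrite -setXT; exact: analytic_setX.
  rewrite (_ : ~` _ = (~` U) `*` setT); last by rewrite !setXT.
  by apply: analytic_setX => //; exact: open_closedC.
- move=> _ [A mA <-]; rewrite setTI -setTX /=.
  rewrite (_ : ~` _ = setT `*` (~` A)); last by rewrite !setTX.
  by split; apply: analytic_setX; (exact: closedT || exact: measurableC || by []).
Qed.

Context (R : realType) (mu : {finite_measure set T -> \bar R}).

(** By compactness, a branch has a common point in [K] as soon as each of its finite stages meets
    [K]. Projection thus turns the scheme into a Suslin scheme of measurable sets in [T]. *)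
Lemma analytic_compact_projection (K : set Y) (B : set (Y * T)) :
  compact K -> analytic_set B ->
  null_sandwich mu [set w | exists2 y, K y & B (y, w)].
Proof.
move=> cK [G [A [cG mA lG lA BE]]].
pose C k a : set T := [set w | K `&` \bigcap_(j in [set j | (j <= k)%N]) G j a !=set0 /\ A k a w].
rewrite (_ : [set w | _] = [set w | exists a, forall k, C k a w]).
  apply: suslin_null_sandwich.
    move=> k a; have [h|h] := pselect (K `&` \bigcap_(j in [set j | (j <= k)%N]) G j a !=set0).
      by rewrite (_ : C k a = A k a)//; apply/seteqP; split=> w; [case|].
    by rewrite (_ : C k a = set0)//; apply/seteqP; split=> w // -[].
  move=> k a b ab; rewrite /C (lA k a b ab).
  suff -> : \bigcap_(j in [set j | (j <= k)%N]) G j a = \bigcap_(j in [set j | (j <= k)%N]) G j b by [].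
  apply: eq_bigcapr => j /= jk; apply: lG => i ij; apply: ab; exact: leq_trans jk.
apply/seteqP; split=> w /=.
  move=> [y Ky /BE[a aP]]; exists a => k; split; last by case: (aP k).
  by exists y; split => // j _; case: (aP j).
move=> [a aP]; move: cK; rewrite compact_In0.
move=> /(_ nat setT (fun k => K `&` \bigcap_(j in [set j | (j <= k)%N]) G j a))[].
- exists (fun k => \bigcap_(j in [set j | (j <= k)%N]) G j a) => // k _.
  by apply: closed_bigI => j _; exact: cG.
- move=> D' _; have [y [Ky yG]] := (aP (\max_(i <- finmap.enum_fset D') i)%N).1.
  (* The stages decrease, so a finite subfamily is governed by its largest index. *)
  exists y => i /= iD'; split => // j /= ji; apply: yG => /=.
  by apply: (leq_trans ji); rewrite (big_rem i)//= leq_maxl.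
move=> y yP; exists y; first by case: (yP 0%N I).
apply/BE; exists a => k; split; last by case: (aP k).
by case: (yP k I) => _; apply => /=.
Qed.

Lemma measurable_projection_null_sandwich (K : nat -> set Y) (B : set (YB * T)) :
  (forall n, compact (K n)) -> \bigcup_n K n = setT -> measurable B ->
  null_sandwich mu [set w | exists y, B (y, w)].
Proof.
move=> cK KT mB.
rewrite (_ : [set w | _] = \bigcup_n [set w | exists2 y, K n y & B (y, w)]).
  apply: null_sandwich_bigcup => n; apply: analytic_compact_projection => //.
  exact: measurable_analytic.
apply/seteqP; split=> w /=; last by move=> [n _ [y _ ?]]; exists y.
move=> [y Byw]; have : [set: Y] y by [].
by rewrite -KT => -[n _ Kny]; exists n => //; exists y.
Qed.

End projection.

(** * Suprema over Euclidean space *)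

Lemma continuous_dist (R : realType) (V : normedModType R) (z : V) :
  continuous (fun y : V => `|y - z|).
Proof. by move=> y; apply: cvg_norm; apply: cvgB; [exact: cvg_id|exact: cvg_cst]. Qed.

Section row_vector_topology.
Context (R : realType) (D : nat).
Implicit Types U : set 'rV[R]_D.

Lemma open_Fsigma_rV U : open U ->
  exists2 F : nat -> set 'rV[R]_D, (forall n, closed (F n)) & U = \bigcup_n F n.
Proof.
(* [F n] consists of the points at distance at least [1 / (n + 1)] from the complement of [U]. *)
move=> oU; exists (fun n => \bigcap_(z in ~` U) [set y | n.+1%:R^-1 <= `|y - z|]).
  move=> n; apply: closed_bigI => z _.
  apply: (@closed_comp _ _ (fun y : 'rV[R]_D => `|y - z|) [set r | n.+1%:R^-1 <= r]).
    by move=> y _; exact: continuous_dist.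
  exact: closed_ge.
apply/seteqP; split=> [y Uy|y [n _ yn]]; last first.
  apply: contrapT => /yn /=; rewrite subrr normr0 leNgt invr_gt0.
  by rewrite ltr0n.
move/nbhs_ballP : (oU y Uy) => [e /= e0 eU].
have [N _ /(_ N (leqnn N)) Ne] := near_infty_natSinv_lt (PosNum e0).
exists N => // z nUz /=; rewrite leNgt; apply/negP => yz; apply: nUz; apply: eU.
rewrite mx_norm_ball; exact: lt_trans Ne.
Qed.

Lemma compact_norm_le_rV (r : R) : compact [set y : 'rV[R]_D | `|y| <= r].
Proof.
apply: bounded_closed_compact.
  exists r; split; first exact: num_real.
  by move=> x rx y /= /le_trans; apply; exact: ltW.
apply: (@closed_comp _ _ (fun y : 'rV[R]_D => `|y|) [set s | s <= r]).
  by move=> y _; exact: norm_continuous.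
exact: closed_le.
Qed.

Lemma bigcup_norm_le_rV : \bigcup_n [set y : 'rV[R]_D | `|y| <= n%:R] = setT.
Proof.
apply/seteqP; split=> // y _; exists (Num.truncn `|y|).+1 => //=.
by rewrite ltW// truncnS_gt.
Qed.

(** An open set is a countable union of sup-norm balls with rational centres and radii
    [1 / (n + 1)], and each such ball is a finite intersection of coordinate conditions. *)
Lemma measurable_rVP d (T : measurableType d) (f : T -> borelRD R D) :
  measurable_fun setT f <-> forall i, measurable_fun setT (fun w => (f w : 'rV[R]_D) ord0 i).
Proof.
split=> [mf i|mf].
  apply: (@measurableT_comp _ _ _ _ _ _ (fun y : borelRD R D => (y : 'rV[R]_D) ord0 i)) => //.
  apply: (measurability _ (RGenOpens.measurableE R)).
  move=> _ [_ [a [b ->]] <-]; rewrite setTI; apply: sub_sigma_algebra.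
  by apply: open_comp; [move=> y _; exact: coord_continuous|exact: interval_open].
apply: (@measurability _ _ _ (borelRD R D) setT f (@open 'rV[R]_D)) => // _ [U oU <-]; rewrite setTI.
(* An enumeration of the rational vectors; codes of nothing are sent to 0. *)
pose q (k : nat) : 'rV[R]_D := odflt 0 (omap (map_mx ratr) (unpickle k : option 'rV[rat]_D)).
rewrite (_ : f @^-1` U = \bigcup_k \bigcup_(n in [set n | ball (q k) n.+1%:R^-1 `<=` U])
    (\bigcap_i (fun w => (f w : 'rV[R]_D) ord0 i) @^-1` ball (q k ord0 i) n.+1%:R^-1)); last first.
  apply/seteqP; split=> w /=.
    move=> Ufw; move/nbhs_ballP : (oU _ Ufw) => [e /= e0 eU].
    have e20 : 0 < e / 2 by rewrite divr_gt0.
    have [N _ /(_ N (leqnn N)) Ne] := near_infty_natSinv_lt (PosNum e20).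
    have N0 : 0 < (N.+1%:R^-1 : R) by rewrite invr_gt0.
    have /choice[p pP] : forall i, exists p : rat, `|ratr p - (f w : 'rV[R]_D) ord0 i| < N.+1%:R^-1.
      move=> i; have /rat_in_itvoo[p] : (f w : 'rV[R]_D) ord0 i - N.+1%:R^-1 < (f w : 'rV[R]_D) ord0 i + N.+1%:R^-1.
        by rewrite ltrD2l (lt_trans _ N0)// oppr_lt0.
      by rewrite in_itv /= => pP; exists p; rewrite ltr_distl.
    exists (pickle (\row_i p i)) => //.
    have qE i : q (pickle (\row_i p i)) ord0 i = ratr (p i).
      by rewrite /q pickleK /= !mxE.
    exists N; last by move=> i _ /=; rewrite qE; exact: pP.
    move=> y [_ by_]; apply: eU; split => // i j; rewrite (ord1 i).
    apply: (@le_ball _ _ _ (N.+1%:R^-1 + N.+1%:R^-1)).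
      by rewrite (splitr e); apply: lerD; exact: ltW.
    apply: (@ball_triangle _ _ (q (pickle (\row_i p i)) ord0 j)); last exact: by_.
    by apply: ball_sym; rewrite qE; exact: pP.
  move=> [k _ [n nU wP]]; apply: nU; split; first by rewrite invr_gt0.
  by move=> i j; rewrite (ord1 i); exact: wP.
apply: bigcupT_measurable => k; apply: bigcup_measurable => n _.
apply: fin_bigcap_measurable => // i _; rewrite -[X in measurable X]setTI.
apply: mf => //; apply: open_measurable; exact: ball_open.
Qed.

End row_vector_topology.

(** * Almost everywhere measurable suprema *)

Section measurable_sup.
Context (R : realType) (D : nat) d (T : measurableType d).
Variable mu : {finite_measure set T -> \bar R}.

Lemma null_sandwich_projection (B : set (borelRD R D * T)) : measurable B ->
  null_sandwich mu [set w | exists y, B (y, w)].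
Proof.
apply: (measurable_projection_null_sandwich (@open_Fsigma_rV R D) mu
  (K := fun n => [set y : 'rV[R]_D | `|y| <= n%:R])).
  by move=> n; exact: compact_norm_le_rV.
exact: bigcup_norm_le_rV.
Qed.

(** The superlevel sets of the supremum are projections, hence squeezed between measurable sets.
    Rebuilding the function from the inner sets at countably many levels changes it only on a null
    set. *)
Lemma sup_ae_measurable (phi : borelRD R D * T -> R) (M : R) :
  measurable_fun setT phi -> (forall p, 0 <= phi p <= M) ->
  exists (h : T -> R) (N : set T), [/\ measurable_fun setT h, forall w, 0 <= h w <= M,
    measurable N, mu N = 0%E &
    forall w, ~ N w -> h w = sup (range (fun y => phi (y, w)))].
Proof.
move=> mphi phiM.
pose q (k : nat) : R := `|ratr (odflt 0 (unpickle k : option rat))|.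
have /choice[A0 /choice[A1 P]] : forall k, null_sandwich mu [set w | exists y, q k < phi (y, w)].
  move=> k; apply: (@null_sandwich_projection [set p | q k < phi p]).
  rewrite -[X in measurable X]setTI (_ : [set p | _] = phi @^-1` `]q k, +oo[%classic).
    exact: mphi.
  by apply/seteqP; split=> p /=; rewrite in_itv /= andbT.
(* A measurable minorant of the supremum: it equals the level [q k] where that level is surely
   exceeded, and 0 elsewhere, which is harmless since [phi] is nonnegative. *)
pose u k w : R := q k * \1_(A0 k) w.
have q0 k : 0 <= q k by exact: normr_ge0.
have u0 k w : 0 <= u k w by rewrite mulr_ge0.
pose s w := sup (range (fun y => phi (y, w))).
have phis y w : phi (y, w) <= s w.
  apply: ub_le_sup; last by exists y.
  by exists M => _ [z _ <-]; case/andP: (phiM (z, w)).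
have s0 w : 0 <= s w by apply: le_trans (phis 0 w); case/andP: (phiM (0, w)).
have sM w : s w <= M.
  apply: ge_sup; first by exists (phi (0, w)); exists 0.
  by move=> _ [z _ <-]; case/andP: (phiM (z, w)).
have us k w : u k w <= s w.
  rewrite /u indicE; case: (boolP (w \in A0 k)); rewrite ?mulr0// mulr1 inE.
  case: (P k) => _ _ sub _ _ /sub[y /ltW/le_trans]; exact.
have ubu w : has_ubound (range (u ^~ w)) by exists (s w) => _ [k _ <-].
pose h w := sups (u ^~ w) 0%N.
have uh k w : u k w <= h w.
  by apply: ub_le_sup; [exists (s w) => _ [j _ <-]|exists k].
have hs w : h w <= s w.
  by apply: ge_sup; [exists (u 0%N w), 0%N|move=> _ [j _ <-]].
exists h, (\bigcup_k (A1 k `\` A0 k)); split.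
- apply: measurable_fun_sups => [w _|k]; first exact: ubu.
  apply: measurable_funM => //; apply: measurable_indic; by case: (P k).
- by move=> w; rewrite (le_trans (u0 0%N w) (uh _ _)) (le_trans (hs _) (sM _)).
- by apply: bigcupT_measurable => k; case: (P k) => *; exact: measurableD.
- have [|N [mN N0 sN]] := @negligible_bigcup _ _ _ mu (fun k => A1 k `\` A0 k).
    by move=> k; exists (A1 k `\` A0 k); case: (P k) => ? ? ? ? ?; split => //; exact: measurableD.
  apply/eqP; rewrite eq_le measure_ge0 andbT -N0; apply: le_measure; rewrite ?inE//.
  by apply: bigcupT_measurable => k; case: (P k) => *; exact: measurableD.
(* A rational strictly between [h w] and the supremum would be one of the levels used to build
   [h]. *)
move=> w nNw; apply/eqP; rewrite eq_le hs/= leNgt; apply/negP => /rat_in_itvoo[r].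
rewrite in_itv /= => /andP[hr /sup_gt[]]; first by exists (phi (0, w)); exists 0.
move=> _ [y _ <-] rphi.
have r0 : 0 <= (ratr r : R) by rewrite (le_trans _ (ltW hr))// (le_trans (u0 0%N w) (uh _ _)).
have qr : q (pickle r) = ratr r by rewrite /q pickleK ger0_norm.
have A1w : A1 (pickle r) w.
  by case: (P (pickle r)) => _ _ _ + _; apply; exists y; rewrite qr.
have A0w : A0 (pickle r) w by apply: contrapT => nA0; apply: nNw; exists (pickle r).
by move: (uh (pickle r) w); rewrite /u qr indicE mem_set// mulr1 leNgt hr.
Qed.

End measurable_sup.

(** * Iterated integrals and Lebesgue measure *)

Section pushforward_of_measurable.
Context d d' (T1 : measurableType d) (T2 : measurableType d') (R : realType).
Variables (m : {measure set T1 -> \bar R}) (f : T1 -> T2).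

(* [pushforward] with the measurability proof as an argument, so that the
   measure structure can be inferred. *)
Definition mpush (mf : measurable_fun setT f) : set T2 -> \bar R := pushforward m f.

Hypothesis mf : measurable_fun setT f.

Let mpush0 : mpush mf set0 = 0%E.
Proof. by rewrite /mpush /pushforward preimage_set0 measure0. Qed.

Let mpush_ge0 A : (0 <= mpush mf A)%E.
Proof. exact: measure_ge0. Qed.

Let mpush_sigma_additive : semi_sigma_additive (mpush mf).
Proof.
move=> F mF tF mUF; rewrite /mpush /pushforward preimage_bigcup.
apply: measure_semi_sigma_additive.
- by move=> n; rewrite -[X in measurable X]setTI; exact: mf.
- apply/trivIsetP => /= i j _ _ ij; rewrite -preimage_setI.
  by move/trivIsetP : tF => /(_ _ _ _ _ ij) ->//; rewrite preimage_set0.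
- by rewrite -preimage_bigcup -[X in measurable X]setTI; exact: mf.
Qed.

HB.instance Definition _ := isMeasure.Build _ _ _
  (mpush mf) mpush0 mpush_ge0 mpush_sigma_additive.

Lemma ge0_integral_mpush (g : T2 -> \bar R) : measurable_fun setT g ->
  (forall y, (0 <= g y)%E) ->
  (\int[mpush mf]_y g y = \int[m]_x g (f x))%E.
Proof. by move=> mg g0; rewrite ge0_integral_pushforward// => y _; exact: g0. Qed.

End pushforward_of_measurable.

Section mpush_probability.
Context d d' (T1 : measurableType d) (T2 : measurableType d') (R : realType).
Variables (P : probability T1 R) (f : T1 -> T2) (mf : measurable_fun setT f).

Let mpush_setT : mpush P mf setT = 1%E.
Proof. exact: probability_setT. Qed.

HB.instance Definition _ := Measure_isProbability.Build _ _ _ (mpush P mf) mpush_setT.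

End mpush_probability.

Lemma sigma_finite_product_measure d1 d2 (T1 : measurableType d1)
    (T2 : measurableType d2) (R : realType)
    (m1 : {sigma_finite_measure set T1 -> \bar R})
    (m2 : {sigma_finite_measure set T2 -> \bar R}) :
  sigma_finite setT (m1 \x m2)%E.
Proof.
have /sigma_finiteP[F [TF ndF Foo]] := sigma_finiteT m1.
have /sigma_finiteP[G [TG ndG Goo]] := sigma_finiteT m2.
exists (fun n => F n `*` G n).
  rewrite -setXTT TF TG; apply/seteqP; split=> -[x y] /=; last first.
    by move=> [n _ []/= ? ?]; split; exists n.
  move=> [[n _ Fnx] [k _ Gky]]; exists (maxn n k) => //; split.
    by move: x Fnx; exact/subsetPset/ndF/leq_maxl.
  by move: y Gky; exact/subsetPset/ndG/leq_maxr.
move=> k; have [? ?] := Foo k; have [? ?] := Goo k; split; first exact: measurableX.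
by rewrite product_measure1E// lte_mul_pinfty// ge0_fin_numE.
Qed.

(** * Lebesgue measure on row vectors, one coordinate at a time *)

Section lebesgue_rV.
Context (R : realType).

Definition rV_cons (m : nat) (p : R * 'rV[R]_m) : 'rV[R]_(m.+1) :=
  row_mx (const_mx p.1 : 'rV_1) p.2.

Lemma rV_cons0 m p : @rV_cons m p ord0 ord0 = p.1.
Proof.
have := row_mxEl (const_mx p.1 : 'rV[R]_1) p.2 ord0 (ord0 : 'I_1).
by rewrite [RHS]mxE => <-; congr (_ _ _); exact/val_inj.
Qed.

Lemma rV_consS m p j : @rV_cons m p ord0 (lift ord0 j) = p.2 ord0 j.
Proof.
have := row_mxEr (const_mx p.1 : 'rV[R]_1) p.2 ord0 j.
by move=> <-; congr (_ _ _); exact/val_inj.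
Qed.

Definition rV_uncons (m : nat) (x : 'rV[R]_(m.+1)) : R * 'rV[R]_m :=
  (x ord0 ord0, \row_j x ord0 (lift ord0 j)).

Lemma rV_consK m : cancel (@rV_cons m) (@rV_uncons m).
Proof.
move=> [t y]; rewrite /rV_uncons rV_cons0; congr pair.
by apply/rowP => j; rewrite mxE rV_consS.
Qed.

Lemma measurable_rV_cons m :
  measurable_fun setT (@rV_cons m : measurableTypeR R * borelRD R m -> borelRD R m.+1).
Proof.
apply/measurable_rVP => j; case: (unliftP ord0 j) => [k|] ->.
  under eq_fun do rewrite rV_consS.
  have /measurable_rVP := @measurable_id _ (borelRD R m) setT.
  by move=> /(_ k) h; exact: (measurableT_comp h measurable_snd).
under eq_fun do rewrite rV_cons0; exact: measurable_fst.
Qed.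

Lemma measurable_rV_uncons m :
  measurable_fun setT (@rV_uncons m : borelRD R m.+1 -> measurableTypeR R * borelRD R m).
Proof.
have /measurable_rVP h := @measurable_id _ (borelRD R m.+1) setT.
apply: measurable_fun_pair; first exact: h.
by apply/measurable_rVP => j; under eq_fun do rewrite mxE; exact: h.
Qed.

Section push_cons.
Context (m : nat) (nu : {sigma_finite_measure set (borelRD R m) -> \bar R}).

Definition push_cons : set (borelRD R m.+1) -> \bar R :=
  mpush (@lebesgue_measure R \x nu)%E (@measurable_rV_cons m).

HB.instance Definition _ := Measure.on push_cons.

Let push_cons_sigma_finite : sigma_finite setT push_cons.
Proof.
have [F FT Foo] := sigma_finite_product_measure (@lebesgue_measure R) nu.
have mu_ := @measurable_rV_uncons m.
exists (fun n => @rV_uncons m @^-1` (F n)).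
  by rewrite -preimage_bigcup -FT preimage_setT.
move=> n; have [mF Fn] := Foo n; split.
  by rewrite -[X in measurable X]setTI; exact: mu_.
rewrite /push_cons /mpush /pushforward -comp_preimage.
by rewrite (_ : _ \o _ = id)// funeqE => p /=; rewrite rV_consK.
Qed.

HB.instance Definition _ := Measure_isSigmaFinite.Build _ _ _ push_cons push_cons_sigma_finite.

End push_cons.

(** The recursion follows that of [iint], so that Tonelli identifies both; sigma-finiteness is
    carried along because Tonelli needs it at each step. *)
Fixpoint lebesgue_rV (D : nat) : {sigma_finite_measure set (borelRD R D) -> \bar R} :=
  match D with
  | 0 => @dirac _ (borelRD R 0) (0 : 'rV[R]_0) R
  | m.+1 => @push_cons m (lebesgue_rV m)
  end.

Lemma iintE (D : nat) (g : borelRD R D -> \bar R) : measurable_fun setT g ->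
  (forall x, (0 <= g x)%E) -> iint g = (\int[lebesgue_rV D]_x g x)%E.
Proof.
elim: D g => [g mg g0|m IH g mg g0] /=.
  by rewrite integral_dirac// diracT mul1e.
have mgc : measurable_fun setT (fun p : measurableTypeR R * borelRD R m => g (rV_cons p)).
  exact: (measurableT_comp mg (@measurable_rV_cons m)).
rewrite ge0_integral_mpush// (fubini_tonelli1 _ mgc)//.
by apply: eq_integral => t _; rewrite IH// => *; exact: (measurableT_comp mgc (pair1_measurable t)).
Qed.

End lebesgue_rV.

(** * Densities and affine changes of variables *)

Section measure_comparison.
Context d (T : measurableType d) (R : realType).

(** The restriction of [m1] to [W] is dominated by [m2] on all measurable sets, and restricting does
    not change an integral over [W]. *)
Lemma ge0_le_measure_integral_in (m1 m2 : {measure set T -> \bar R}) (W : set T)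
    (g : T -> \bar R) : measurable W ->
  (forall S, measurable S -> S `<=` W -> (m1 S <= m2 S)%E) ->
  measurable_fun setT g -> (forall x, (0 <= g x)%E) ->
  (\int[m1]_(x in W) g x <= \int[m2]_(x in W) g x)%E.
Proof.
move=> mW m12 mg g0.
rewrite (@eq_measure_integral _ _ _ _ (mrestr m1 mW)); last first.
  by move=> A mA AW; rewrite -[in LHS](setIidl AW).
apply: ge0_le_measure_integral => // S mS.
apply: (@le_trans _ _ (m2 (S `&` W))); first by apply: m12 => //; exact: measurableI.
by apply: le_measure; rewrite ?inE//; exact: measurableI.
Qed.

Lemma integral_support (m : {measure set T -> \bar R}) (W : set T) (g : T -> \bar R) :
  (forall x, ~ W x -> g x = 0%E) -> (\int[m]_(x in W) g x = \int[m]_x g x)%E.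
Proof.
move=> gW; rewrite integral_mkcond; apply: eq_integral => x _.
by rewrite patchE; case: ifPn => //; rewrite notin_setE => /gW.
Qed.

Context (leb mu : {measure set T -> \bar R}) (f : T -> R).
Hypotheses (mf : measurable_fun setT f) (f0 : forall x, 0 <= f x)
  (muE : forall B, measurable B -> (mu B = \int[leb]_x ((f x)%:E * (\1_B x)%:E))%E).

(** On the positivity set of [g], [mu] is at most [c] times [leb]. The null set [N] will be the
    sphere bounding the support of a kernel translate, where [f <= c] may fail. *)
Lemma integral_density_le (c : R) (N : set T) (g : T -> R) : 0 <= c ->
  measurable N -> leb N = 0%E ->
  measurable_fun setT g -> (forall x, 0 <= g x) ->
  (forall x, 0 < g x -> ~ N x -> f x <= c) ->
  (\int[mu]_x (g x)%:E <= c%:E * \int[leb]_x (g x)%:E)%E.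
Proof.
move=> c0 mN N0 mg g0 gc.
pose W := [set x | 0 < g x].
have mW : measurable W.
  rewrite (_ : W = setT `&` g @^-1` `]0, +oo[%classic); first exact: mg.
  by rewrite setTI; apply/seteqP; split=> x /=; rewrite in_itv /= andbT.
have gW x : ~ W x -> (g x)%:E = 0%E.
  by move=> /negP; rewrite -leNgt => gx; congr EFin; apply/eqP; rewrite eq_le gx g0.
have mgE : measurable_fun setT (EFin \o g) by exact/measurable_EFinP.
rewrite -(integral_support mu gW) -(integral_support leb gW).
have mgW : measurable_fun W (EFin \o g) by exact: measurable_funS mgE.
rewrite -(@ge0_integral_mscale _ _ _ leb _ mW (NngNum c0) _ mgW)/=; last first.
  by move=> x _; rewrite lee_fin.
apply: ge0_le_measure_integral_in => // S mS SW.
rewrite [X in (_ <= X)%E](_ : _ = (c%:E * \int[leb]_x (\1_S x)%:E)%E); last first.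
  by rewrite integral_indic// setIT.
rewrite muE// -ge0_integralZl//=; last first.
  by apply/measurable_EFinP; exact: measurable_indic.
apply: ae_ge0_le_integral => //=.
- by move=> x _; rewrite mule_ge0 ?lee_fin.
- by apply/measurable_EFinP/measurable_funM => //; exact: measurable_indic.
- by move=> x _; rewrite mule_ge0 ?lee_fin.
- by apply/measurable_EFinP/measurable_funM => //; exact: measurable_indic.
exists N; split => // x /= nle; apply: contrapT => nNx; apply: nle => _.
rewrite -!EFinM lee_fin indicE; case: (boolP (x \in S)); rewrite ?mulr0//= !mulr1.
by rewrite inE => /SW /gc; exact.
Qed.

Lemma integral_density_ge (c : R) (g : T -> R) : 0 <= c ->
  measurable_fun setT g -> (forall x, 0 <= g x) ->
  (forall x, 0 < g x -> c <= f x) ->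
  (c%:E * \int[leb]_x (g x)%:E <= \int[mu]_x (g x)%:E)%E.
Proof.
move=> c0 mg g0 gc.
pose W := [set x | 0 < g x].
have mW : measurable W.
  rewrite (_ : W = setT `&` g @^-1` `]0, +oo[%classic); first exact: mg.
  by rewrite setTI; apply/seteqP; split=> x /=; rewrite in_itv /= andbT.
have gW x : ~ W x -> (g x)%:E = 0%E.
  by move=> /negP; rewrite -leNgt => gx; congr EFin; apply/eqP; rewrite eq_le gx g0.
have mgE : measurable_fun setT (EFin \o g) by exact/measurable_EFinP.
rewrite -(integral_support mu gW) -(integral_support leb gW).
have mgW : measurable_fun W (EFin \o g) by exact: measurable_funS mgE.
rewrite -(@ge0_integral_mscale _ _ _ leb _ mW (NngNum c0) _ mgW)/=; last first.
  by move=> x _; rewrite lee_fin.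
apply: ge0_le_measure_integral_in => // S mS SW.
rewrite [X in (X <= _)%E](_ : _ = (c%:E * \int[leb]_x (\1_S x)%:E)%E); last first.
  by rewrite integral_indic// setIT.
rewrite muE// -ge0_integralZl//=; last first.
  by apply/measurable_EFinP; exact: measurable_indic.
apply: ge0_le_integral => //=.
- by move=> x _; rewrite mule_ge0 ?lee_fin.
- by apply/measurable_EFinP/measurable_funM => //; exact: measurable_indic.
- by apply/measurable_EFinP/measurable_funM => //; exact: measurable_indic.
move=> x _; rewrite -!EFinM lee_fin indicE; case: (boolP (x \in S)); rewrite ?mulr0//= !mulr1.
by rewrite inE => /SW /gc; exact.
Qed.

End measure_comparison.

(** * Affine substitutions and null spheres *)

Section affine_change_of_variables.
Context (R : realType).
Variables (h : R) (h0 : 0 < h).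

Lemma measurable_affine (a : R) :
  measurable_fun setT (fun t : measurableTypeR R => h^-1 * (a - t) : measurableTypeR R).
Proof. by apply: measurable_funM => //; exact: measurable_funB. Qed.

Lemma ge0_integral_affine (a : R) (phi : R -> \bar R) : measurable_fun setT phi ->
  (forall t, (0 <= phi t)%E) ->
  (\int[@lebesgue_measure R]_t phi (h^-1 * (a - t))%R =
   h%:E * \int[@lebesgue_measure R]_t phi t)%E.
Proof.
move=> mphi phi0.
have hi0 : 0 <= h^-1 by rewrite invr_ge0 ltW.
rewrite -(@ge0_integral_mpush _ _ _ _ _ _ _ (@measurable_affine a))//.
(* The rescaled image measure agrees with Lebesgue measure on half-open intervals, hence everywhere.
   The map is decreasing, so the open and closed ends are exchanged. *)
pose nu := mscale (NngNum hi0) (mpush (@lebesgue_measure R) (@measurable_affine a)).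
have nuE (A : set R) : measurable A -> lebesgue_measure A = nu A.
  apply: lebesgue_measure_unique => _ [[c e] _ <-].
  have pE : (fun t : R => h^-1 * (a - t)) @^-1` `]c, e]%classic = `[a - h * e, a - h * c[%classic.
    apply/seteqP; split=> t /=; rewrite !in_itv/= [_^-1 * _]mulrC.
      by rewrite ltr_pdivlMr// ler_pdivrMr// => /andP[? ?]; apply/andP; split; lra.
    by rewrite ltr_pdivlMr// ler_pdivrMr// => /andP[? ?]; apply/andP; split; lra.
  transitivity ((h^-1)%:E * lebesgue_measure (`[(a - h * e)%R, (a - h * c)%R[%classic : set R))%E; last first.
    by rewrite -pE.
  rewrite !lebesgue_measure_itv/= !lte_fin ltrD2l ltrN2 ltr_pM2l//.
  case: ifPn => _; last by rewrite mule0.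
  by rewrite -!EFinD -EFinM; congr EFin; field; rewrite gt_eqF.
rewrite [in RHS](@eq_measure_integral _ _ _ _ nu); last by move=> A mA _; exact: nuE.
rewrite ge0_integral_mscale//= muleA -EFinM divff ?mul1e//; by rewrite gt_eqF.
Qed.

End affine_change_of_variables.

Lemma scale_subE (R : realType) D (c : R) (x y : 'rV[R]_D) j :
  (c *: (x - y)) ord0 j = c * (x ord0 j - y ord0 j).
Proof. by rewrite !mxE. Qed.

Lemma iint_affine (R : realType) (h : R) (h0 : 0 < h) D (x : 'rV[R]_D)
    (g : borelRD R D -> \bar R) : measurable_fun setT g -> (forall y, (0 <= g y)%E) ->
  iint (fun y : 'rV[R]_D => g (h^-1 *: (x - y))) = ((h ^+ D)%:E * iint g)%E.
Proof.
elim: D x g => [x g mg g0|m IH x g mg g0] /=.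
  by rewrite expr0 mul1e; congr g; apply/rowP => -[].
have mgc : measurable_fun setT (fun p : measurableTypeR R * borelRD R m => g (rV_cons p)).
  exact: (measurableT_comp mg (@measurable_rV_cons R m)).
have mgct t : measurable_fun setT (fun y : borelRD R m => g (rV_cons (t, y))).
  exact: (measurableT_comp mgc (pair1_measurable t)).
pose phi t := iint (fun y : 'rV[R]_m => g (rV_cons (t, y))).
have phiE : phi = (fun t => \int[lebesgue_rV R m]_y g (rV_cons (t, y)))%E.
  by apply/funext => t; rewrite /phi iintE.
have mphi : measurable_fun setT phi.
  by rewrite phiE; exact: (measurable_fun_fubini_tonelli_F _ mgc).
have phi0 t : (0 <= phi t)%E by rewrite phiE; exact: integral_ge0.
transitivity (\int[@lebesgue_measure R]_t
    ((h ^+ m)%:E * phi (h^-1 * (x ord0 ord0 - t))%R))%E.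
  apply: eq_integral => t _.
  rewrite -(IH (\row_j x ord0 (lift ord0 j)) (fun y => g (rV_cons (h^-1 * (x ord0 ord0 - t), y))))//.
  congr iint; apply/funext => y; congr g; apply/rowP => j.
  rewrite scale_subE -/(rV_cons (t, y)); case: (unliftP ord0 j) => [k|] ->.
    by rewrite !rV_consS scale_subE mxE.
  by rewrite !rV_cons0.
have mphia : measurable_fun setT (fun t : R => phi (h^-1 * (x ord0 ord0 - t))).
  exact: (measurableT_comp mphi (@measurable_affine R h (x ord0 ord0))).
rewrite ge0_integralZl//; last by rewrite lee_fin exprn_ge0// ltW.
by rewrite ge0_integral_affine// muleA -EFinM exprSr.
Qed.

(** Freezing the first coordinate leaves a sphere of one dimension less. In dimension 0 the sphere
    with [r = 0] is the whole one-point space, which has mass 1. *)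
Lemma iint_sphere (R : realType) D (x : 'rV[R]_D) (r : R) : (D = 0%N -> r != 0) ->
  iint (fun y : 'rV[R]_D => (\1_[set y : 'rV[R]_D | \sum_(i < D) (x ord0 i - y ord0 i) ^+ 2 = r] y)%:E) = 0%E.
Proof.
elim: D x r => [x r r0|m IH x r _] /=.
  rewrite indicE memNset//= big_ord0 => /esym/eqP; apply/negP; exact: r0.
pose x' : 'rV[R]_m := \row_j x ord0 (lift ord0 j).
have E t : iint (fun y : 'rV[R]_m => (\1_[set y : 'rV[R]_m.+1 | \sum_(i < m.+1) (x ord0 i - y ord0 i) ^+ 2 = r] (rV_cons (t, y)))%:E)
   = iint (fun y : 'rV[R]_m => (\1_[set y : 'rV[R]_m | \sum_(i < m) (x' ord0 i - y ord0 i) ^+ 2 = r - (x ord0 ord0 - t) ^+ 2] y)%:E).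
  congr iint; apply/funext => y; rewrite !indicE; congr (_%:R%:E); congr nat_of_bool.
  apply/idP/idP; rewrite !inE /= big_ord_recl rV_cons0 /=.
    by move=> <-; rewrite addrC addKr; apply: eq_bigr => i _; rewrite rV_consS mxE.
  move=> H; rewrite -[RHS](subrK ((x ord0 ord0 - t) ^+ 2)) -H addrC; congr +%R.
  by apply: eq_bigr => i _; rewrite rV_consS mxE.
under eq_integral do rewrite -/(rV_cons (_, _)) E.
(* In dimension 1 the induction hypothesis could face [r = 0]; there the sphere is a set of at most
   two reals instead. *)
case: m => [|m] in x x' IH E *; last first.
  by apply: integral0_eq => t _; rewrite IH.
pose Z := [set t : R | (x ord0 ord0 - t) ^+ 2 = r].
have cZ : countable Z.
  apply: finite_set_countable.
  apply: (@sub_finite_set _ _ [set x ord0 ord0 - Num.sqrt r; x ord0 ord0 + Num.sqrt r]); last first.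
    exact: finite_set2.
  move=> t /= <-; rewrite sqrtr_sqr.
  by case: (ger0P (x ord0 ord0 - t)) => _; [left|right] => /=; ring.
have mZ : measurable Z by exact: countable_measurable.
transitivity (\int[@lebesgue_measure R]_t (\1_Z t)%:E)%E.
  apply: eq_integral => t _ /=; rewrite !indicE; congr (_%:R%:E); congr nat_of_bool.
  apply/idP/idP; rewrite !inE /= big_ord0; first by move/eqP; rewrite eq_sym subr_eq0 eq_sym => /eqP.
  by rewrite /Z/= => ->; rewrite subrr.
by rewrite integral_indic// setIT; exact: countable_lebesgue_measure0.
Qed.

(** * Rademacher averages and chaining *)

Section rademacher_average.
Context (R : realType) (n : nat).
Implicit Types (s : {ffun 'I_n -> bool}) (u w : 'I_n -> R).

Definition signed_sum s u : R := \sum_i (-1) ^+ s i * u i.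

(** Expectation over independent uniform signs, as a finite average. *)
Definition sign_average (G : {ffun 'I_n -> bool} -> R) : R :=
  (2 ^+ n)^-1 * \sum_s G s.

Lemma card_signs : \sum_(s : {ffun 'I_n -> bool}) (1 : R) = 2 ^+ n.
Proof. by rewrite sumr_const card_ffun card_bool card_ord -natrX. Qed.

Lemma le_sign_average G1 G2 : (forall s, G1 s <= G2 s) ->
  sign_average G1 <= sign_average G2.
Proof. by move=> G12; rewrite ler_wpM2l ?invr_ge0 ?exprn_ge0//; exact: ler_sum. Qed.

Lemma sign_averageD G1 G2 :
  sign_average (fun s => G1 s + G2 s) = sign_average G1 + sign_average G2.
Proof. by rewrite /sign_average big_split mulrDr. Qed.

Lemma sign_averageZ c G : sign_average (fun s => c * G s) = c * sign_average G.
Proof. by rewrite /sign_average -mulr_sumr mulrCA. Qed.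

Lemma sign_average_cst c : sign_average (fun=> c) = c.
Proof.
have -> : (fun=> c) = (fun s : {ffun 'I_n -> bool} => c * 1) by apply/funext => s; rewrite mulr1.
by rewrite sign_averageZ /sign_average card_signs mulVf ?mulr1// expf_neq0.
Qed.

Lemma sign_average_sum (J : finType) (G : J -> {ffun 'I_n -> bool} -> R) :
  sign_average (fun s => \sum_j G j s) = \sum_j sign_average (G j).
Proof. by rewrite /sign_average exchange_big mulr_sumr. Qed.

Lemma signed_sumB s u w : signed_sum s (fun i => u i - w i) = signed_sum s u - signed_sum s w.
Proof. by rewrite /signed_sum -sumrB; apply: eq_bigr => i _; rewrite mulrBr. Qed.

Lemma norm_signed_sum s u : `|signed_sum s u| <= \sum_i `|u i|.
Proof.
apply: (le_trans (ler_norm_sum _ _ _)); apply: ler_sum => i _.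
by rewrite normrM normrX normrN1 expr1n mul1r.
Qed.

(** The generous constant 2 allows an elementary proof: for small [x], [expR x <= 1 / (1 - x)]
    reduces the claim to [1 / (1 - x ^+ 2) <= 1 + 2 * x ^+ 2]; otherwise [|x| <= 2 * x ^+ 2]. *)
Lemma cosh_le (x : R) : (expR x + expR (- x)) / 2 <= expR (2 * x ^+ 2).
Proof.
have [x2|x2] := leP (x ^+ 2) (1 / 2).
  have x1 : `|x| < 1.
    rewrite ltNge; apply/negP => /(exprn_ege1 2).
    by rewrite real_normK ?num_real//; lra.
  have /andP[xl xr] : - 1 < x < 1 by rewrite -ltr_norml.
  have e1 : expR x <= (1 - x)^-1.
    rewrite -[expR x]invrK lef_pV2 ?posrE ?invr_gt0 ?expR_gt0//; last lra.
    by rewrite -expRN; apply: le_trans (expR_ge1Dx _); lra.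
  have e2 : expR (- x) <= (1 + x)^-1.
    rewrite expRN lef_pV2 ?posrE ?expR_gt0//; last lra.
    exact: expR_ge1Dx.
  apply: le_trans (expR_ge1Dx _).
  have -> : 1 + 2 * x ^+ 2 = ((1 - x)^-1 + (1 + x)^-1) / 2 + x ^+ 2 * (1 - 2 * x ^+ 2) / (1 - x ^+ 2).
    by field; rewrite !gt_eqF//; nra.
  have : 0 <= x ^+ 2 * (1 - 2 * x ^+ 2) / (1 - x ^+ 2).
    by apply: divr_ge0; [apply: mulr_ge0; [exact: sqr_ge0|lra]|lra].
  lra.
have h : `|x| <= 2 * x ^+ 2.
  rewrite -(real_normK (num_real x)) in x2 *; have := normr_ge0 x; nra.
have : expR x <= expR (2 * x ^+ 2) by rewrite ler_expR (le_trans (ler_norm x)).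
have : expR (- x) <= expR (2 * x ^+ 2) by rewrite ler_expR (le_trans (ler_norm (- x)))// normrN.
lra.
Qed.

(** Hoeffding's sub-Gaussian bound: the average of the exponential factors over the coordinates into
    hyperbolic cosines. *)
Lemma sign_average_expR u (t : R) :
  sign_average (fun s => expR (t * signed_sum s u)) <= expR (2 * t ^+ 2 * \sum_i u i ^+ 2).
Proof.
have E s : expR (t * signed_sum s u) = \prod_i expR (t * ((-1) ^+ s i * u i)).
  by rewrite mulr_sumr expR_sum.
rewrite /sign_average; under eq_bigr do rewrite E.
rewrite -(bigA_distr_bigA (fun i b => expR (t * ((-1) ^+ nat_of_bool b * u i)))) -exprVn.
rewrite -[in X in X * _](card_ord n) -prodr_const -big_split /= mulr_sumr expR_sum.
apply: ler_prod => i _; apply/andP; split.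
  by apply: mulr_ge0; [rewrite invr_ge0|apply: sumr_ge0 => b _; exact: expR_ge0].
rewrite big_bool /= expr0 expr1 mul1r mulN1r mulrN.
have := cosh_le (t * u i); rewrite exprMn mulrA; apply: le_trans.
by rewrite addrC mulrC.
Qed.

(* [theta y <= ln M - 1 + exp (theta y) / M] replaces the maximum over [J] by a sum
   of exponentials, whose sign average is computed above. *)
Lemma sign_average_maximal (J : finType) (u : J -> 'I_n -> R) (r2 theta L : R) :
  0 < theta -> (forall j, \sum_i u j i ^+ 2 <= r2) -> 2 * #|J|%:R <= expR L ->
  exists G : {ffun 'I_n -> bool} -> R,
    (forall s j, `|signed_sum s (u j)| <= G s) /\
    sign_average G <= L / theta + 2 * theta * r2.
Proof.
move=> t0 ur cJ.
(* [expR LM] will bound the averaged sum of all exponentials; the factor 2 in front of [#|J|] pays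
   for both signs needed by the absolute value. *)
pose LM := L + 2 * theta ^+ 2 * r2.
pose e s j := expR (theta * signed_sum s (u j)) + expR ((- theta) * signed_sum s (u j)).
exists (fun s => theta^-1 * ((LM - 1) + expR (- LM) * \sum_j e s j)); split.
  move=> s j; rewrite -(ler_pM2l t0) mulrA divff ?gt_eqF// mul1r.
  have key y : theta * y <= LM - 1 + expR (- LM) * expR (theta * y).
    by rewrite -expRD; have := expR_ge1Dx (- LM + theta * y); lra.
  have le1 : expR (theta * `|signed_sum s (u j)|) <= \sum_j e s j.
    apply: (@le_trans _ _ (e s j)).
      rewrite /e; case: (ger0P (signed_sum s (u j))) => _; rewrite ?mulrN -?mulNr.
        by rewrite lerDl expR_ge0.
      by rewrite lerDr expR_ge0.
    rewrite (bigD1 j)//= lerDl; apply: sumr_ge0 => k _.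
    by rewrite addr_ge0// expR_ge0.
  apply: le_trans (key _) _; rewrite lerD2l ler_wpM2l// expR_ge0//.
rewrite sign_averageZ sign_averageD sign_average_cst sign_averageZ sign_average_sum.
have sj j : sign_average (e^~ j) <= 2 * expR (2 * theta ^+ 2 * r2).
  rewrite sign_averageD.
  have h (t : R) : t ^+ 2 = theta ^+ 2 ->
      sign_average (fun s => expR (t * signed_sum s (u j))) <= expR (2 * theta ^+ 2 * r2).
    move=> t2; apply: le_trans (sign_average_expR _ _) _.
    by rewrite t2 ler_expR ler_wpM2l// mulr_ge0// sqr_ge0.
  by have := h theta erefl; have := h (- theta) (sqrrN _); lra.
have tot : \sum_j sign_average (e^~ j) <= expR LM.
  apply: (@le_trans _ _ (\sum_(j : J) 2 * expR (2 * theta ^+ 2 * r2))); first exact: ler_sum.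
  rewrite sumr_const -[_ *+ _]mulr_natr mulrAC /LM expRD ler_wpM2r ?expR_ge0//.
have fin : expR (- LM) * \sum_j sign_average (e^~ j) <= 1.
  by rewrite expRN mulrC ler_pdivrMr ?expR_gt0// mul1r.
have -> : L / theta + 2 * theta * r2 = theta^-1 * LM.
  by rewrite /LM; field; rewrite gt_eqF.
apply: ler_wpM2l; first by rewrite invr_ge0 ltW.
apply: (@le_trans _ _ (LM - 1 + 1)); [rewrite lerD2l; exact: fin|lra].
Qed.

(* Dudley's chaining with a free parameter [kappa] instead of square roots: the
   links of level [k] are weighted by [theta = (k + 1) 2^k / kappa]. *)
Lemma chaining (I : Type) (a : I -> 'I_n -> R) (S : {ffun 'I_n -> bool} -> R)
    (V B2 kappa L : R) (m : nat -> nat) (b : forall k, 'I_(m k) -> 'I_n -> R) :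
  0 < kappa -> 0 <= V -> 0 <= B2 -> 0 <= L ->
  (forall x, \sum_i a x i ^+ 2 <= V) ->
  (forall k x, exists j, \sum_i (a x i - b k j i) ^+ 2 <= B2 * 4^-1 ^+ k) ->
  2 * (m 0%N)%:R <= expR L ->
  (forall k, 2 * ((m k)%:R * (m k.+1)%:R) <= expR (k.+1%:R * L)) ->
  (forall s M, (forall x, `|signed_sum s (a x)| <= M) -> S s <= M) ->
  sign_average S <= 36 * (kappa * L + (V + B2) / kappa).
Proof.
move=> k0 V0 B0 L0 aV cov m0 mS supS.
pose R2 := V + B2.
pose h k : R := 2^-1 ^+ k.
have h0 k : 0 < h k by rewrite exprn_gt0// invr_gt0.
have hh k : 4^-1 ^+ k = h k ^+ 2.
  by rewrite /h -exprM mulnC exprM; congr (_ ^+ k); field.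
have sqD (p q : R) : (p + q) ^+ 2 <= 2 * p ^+ 2 + 2 * q ^+ 2.
  by have := sqr_ge0 (p - q); rewrite !expr2; lra.
(* Closed form of the partial sums: level [k] adds [kappa * L * h k] and
   [8 * (k + 1) * h k * R2 / kappa]. *)
pose bound k := kappa * L * (3 - 2 * h k) + R2 / kappa * (36 - 16 * (k%:R + 2) * h k).
have chain K : exists G : {ffun 'I_n -> bool} -> R, sign_average G <= bound K /\
    forall s x j, \sum_i (a x i - b K j i) ^+ 2 <= B2 * 4^-1 ^+ K -> `|signed_sum s (b K j)| <= G s.
  elim: K => [|K [G [GK Gb]]].
    (* Centres too large to be close to any [a x] are replaced by 0, so that the variance bound
       holds for all of them. *)
    pose u (j : 'I_(m 0%N)) := if \sum_i b 0%N j i ^+ 2 <= 2 * R2 then b 0%N j else fun=> 0.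
    have [|||G [Gu GL]] := @sign_average_maximal _ u (2 * R2) kappa^-1 L.
    - by rewrite invr_gt0.
    - move=> j; rewrite /u; case: ifP => // _.
      by rewrite big1 ?mulr_ge0 ?addr_ge0// => i _; rewrite expr0n.
    - by rewrite card_ord.
    exists G; split.
      apply: le_trans GL _; rewrite /bound /h expr0 invrK.
      by rewrite le_eqVlt; apply/orP; left; apply/eqP; field; rewrite gt_eqF.
    move=> s x j; rewrite expr0 mulr1 => abj.
    have uj : u j = b 0%N j.
      rewrite /u ifT//.
      apply: (@le_trans _ _ (\sum_i (2 * a x i ^+ 2 + 2 * (a x i - b 0%N j i) ^+ 2))).
        apply: ler_sum => i _; have := sqD (a x i) (- (a x i - b 0%N j i)).
        by rewrite sqrrN opprB addrC subrK.
      by rewrite big_split /= -!mulr_sumr; have := aV x; rewrite /R2; lra.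
    by rewrite -uj; exact: Gu.
  pose w (p : 'I_(m K) * 'I_(m K.+1)) i := b K p.1 i - b K.+1 p.2 i.
  pose r2 := 4 * R2 * h K ^+ 2.
  (* Likewise only the links between centres close to a common [a x] matter; their squared length is
     at most [r2]. *)
  pose u p := if \sum_i w p i ^+ 2 <= r2 then w p else fun=> 0.
  have R20 : 0 <= R2 by exact: addr_ge0.
  have t0 : 0 < K.+1%:R / (kappa * h K) by rewrite divr_gt0// mulr_gt0.
  have [||H [Hu HL]] := @sign_average_maximal _ u r2 (K.+1%:R / (kappa * h K)) (K.+1%:R * L) t0.
  - move=> p; rewrite /u; case: ifP => // _.
    rewrite big1 => [|i _]; last by rewrite expr0n.
    by apply: mulr_ge0; [exact: mulr_ge0|exact: sqr_ge0].
  - by rewrite card_prod !card_ord natrM.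
  exists (fun s => G s + H s); split.
    rewrite sign_averageD; apply: le_trans (lerD GK HL) _.
    rewrite le_eqVlt; apply/orP; left; apply/eqP.
    rewrite /bound /r2 /R2 (_ : h K.+1 = h K / 2); last by rewrite /h exprSr.
    rewrite -natr1; have K0 : K%:R + 1 != 0 :> R by rewrite natr1.
    by field; rewrite addrC K0 !gt_eqF.
  move=> s x j abj; have [j' abj'] := cov K x.
  have uj : u (j', j) = w (j', j).
    rewrite /u ifT//.
    apply: (@le_trans _ _ (\sum_i (2 * (a x i - b K j' i) ^+ 2 + 2 * (a x i - b K.+1 j i) ^+ 2))).
      apply: ler_sum => i _; rewrite /w /=.
      have := sqD (- (a x i - b K j' i)) (a x i - b K.+1 j i).
      by rewrite sqrrN opprB addrA subrK.
    rewrite big_split /= -!mulr_sumr /r2 -hh /R2.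
    move: abj abj'; rewrite exprSr [B2 * (_ * _)]mulrA.
    have q0 : 0 <= 4^-1 ^+ K :> R by rewrite exprn_ge0// invr_ge0.
    by have := mulr_ge0 V0 q0; have := mulr_ge0 B0 q0; lra.
  have := Hu s (j', j); rewrite uj /w /= signed_sumB; have := Gb s x j' abj'.
  move=> l1 l2; rewrite -[signed_sum s (b K.+1 j)](subKr (signed_sum s (b K j'))).
  apply: le_trans (ler_normB _ _) _; exact: lerD.
(* The last piece from [b K] to [a x] is bounded in absolute value through
   [|q| <= q ^+ 2 / h K + h K]; it vanishes as [K] grows because [n] is fixed. *)
have tail K : sign_average S <= 36 * (kappa * L + R2 / kappa) + h K * (B2 + n%:R).
  have [G [GK Gb]] := chain K.
  apply: (@le_trans _ _ (sign_average (fun s => G s + h K * (B2 + n%:R)))).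
    apply: le_sign_average => s; apply: supS => x.
    have [j abj] := cov K x.
    have -> : signed_sum s (a x) = signed_sum s (b K j) + signed_sum s (fun i => a x i - b K j i).
      by rewrite signed_sumB addrC subrK.
    apply: le_trans (ler_normD _ _) _; apply: lerD; first exact: Gb abj.
    apply: le_trans (norm_signed_sum _ _) _.
    apply: (@le_trans _ _ (\sum_i ((h K)^-1 * (a x i - b K j i) ^+ 2 + h K))).
      apply: ler_sum => i _; set q := _ - _.
      rewrite -(real_normK (num_real q)) -(ler_pM2l (h0 K)) mulrDr mulrA divff ?gt_eqF// mul1r.
      by have := normr_ge0 q; have := sqr_ge0 (`|q| - h K); rewrite !expr2; have := h0 K; nra.
    rewrite big_split /= -mulr_sumr sumr_const card_ord -[_ *+ _]mulr_natr mulrDr lerD2r.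
    rewrite ler_pdivrMl// mulrA -expr2 -hh mulrC; exact: abj.
  rewrite sign_averageD sign_average_cst lerD2r; apply: le_trans GK _.
  have hK := ltW (h0 K); have kL : 0 <= kappa * L by rewrite mulr_ge0// ltW.
  have Rk : 0 <= R2 / kappa by rewrite divr_ge0 ?addr_ge0// ltW.
  have K2 : 0 <= K%:R + 2 :> R by exact: addr_ge0.
  have := mulr_ge0 kL hK; have := mulr_ge0 Rk (mulr_ge0 K2 hK).
  by rewrite /bound; lra.
apply/ler_addgt0Pr => e e0.
have C0 : 0 < B2 + n%:R + 1 by rewrite ltr_wpDl// addr_ge0.
have [K hK] : exists K, h K < e / (B2 + n%:R + 1).
  have h1 : `|2^-1 : R| < 1 by rewrite ger0_norm; lra.
  have /cvgrPdist_lt/(_ _ (divr_gt0 e0 C0)) [K _ /(_ K (leqnn K))] := @cvg_expr R _ h1.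
  by rewrite /= sub0r normrN ger0_norm ?ltW//; exists K.
apply: le_trans (tail K) _; rewrite lerD2l.
apply: (@le_trans _ _ (h K * (B2 + n%:R + 1))); first by rewrite ler_wpM2l ?lerDl// ltW.
by rewrite -ler_pdivlMr// ltW.
Qed.

End rademacher_average.

(** * Ghost samples *)

Section product_square.
Context d (Omega : measurableType d) (R : realType) (P : probability Omega R).

Definition prob_square : set (Omega * Omega) -> \bar R := (P \x P)%E.

HB.instance Definition _ := Measure.on prob_square.

Let prob_square_setT : prob_square setT = 1%E.
Proof.
by rewrite /prob_square -setXTT product_measure1E// [X in (X * _)%E]probability_setT
  [X in (_ * X)%E]probability_setT mule1.
Qed.

HB.instance Definition _ := Measure_isProbability.Build _ _ _ prob_square prob_square_setT.

Lemma prob_squareX (A B : set Omega) : measurable A -> measurable B ->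
  prob_square (A `*` B) = (P A * P B)%E.
Proof. by move=> mA mB; rewrite /prob_square product_measure1E. Qed.

Lemma integral_prob_square (f : Omega * Omega -> \bar R) : measurable_fun setT f ->
  (forall p, (0 <= f p)%E) ->
  (\int[prob_square]_p f p = \int[P]_w \int[P]_w' f (w, w'))%E.
Proof. by move=> mf f0; exact: fubini_tonelli1. Qed.

Lemma integral_prob_square_fst (f : Omega -> \bar R) : measurable_fun setT f ->
  (forall p, (0 <= f p)%E) ->
  (\int[prob_square]_p f p.1 = \int[P]_w f w)%E.
Proof.
move=> mf f0; rewrite integral_prob_square//; last exact: (measurableT_comp mf measurable_fst).
apply: eq_integral => w _ /=; rewrite -/(cst (f w)) integral_cst//.
by rewrite [X in (_ * X)%E]probability_setT mule1.
Qed.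

Lemma integral_prob_square_snd (f : Omega -> \bar R) : measurable_fun setT f ->
  (forall p, (0 <= f p)%E) ->
  (\int[prob_square]_p f p.2 = \int[P]_w f w)%E.
Proof.
move=> mf f0; rewrite integral_prob_square//; last exact: (measurableT_comp mf measurable_snd).
rewrite -/(cst (\int[P]_w' f w')%E) integral_cst//.
by rewrite [X in (_ * X)%E]probability_setT mule1.
Qed.

Lemma prob_square_section_ae (A : set (Omega * Omega)) : measurable A ->
  prob_square A = 0%E -> {ae P, forall w, P (xsection A w) = 0%E}.
Proof.
move=> mA A0.
have mF : measurable_fun setT (fun w => P (xsection A w)) by exact: measurable_fun_xsection.
have /(ae_eq_integral_abs P measurableT mF) : (\int[P]_w `|P (xsection A w)| = 0)%E.
  rewrite -[RHS]A0; apply: eq_integral => w _; rewrite gee0_abs//.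
by apply: filterS => w; exact.
Qed.

Lemma prob_square_fst_ae (Q : Omega -> Prop) : {ae P, forall w, Q w} ->
  {ae prob_square, forall p, Q p.1}.
Proof.
move=> [N [mN N0 QN]]; exists (N `*` setT); split; first exact: measurableX.
  by rewrite prob_squareX// N0 mul0e.
by move=> -[w w'] /= nQ; split => //; exact: QN.
Qed.

Lemma prob_square_snd_ae (Q : Omega -> Prop) : {ae P, forall w, Q w} ->
  {ae prob_square, forall p, Q p.2}.
Proof.
move=> [N [mN N0 QN]]; exists (setT `*` N); split; first exact: measurableX.
  by rewrite prob_squareX// N0 mule0.
by move=> -[w w'] /= nQ; split => //; exact: QN.
Qed.

End product_square.

(** * Exchanging a sample with its ghost *)

Section ghost_sample.
Context d (Omega : measurableType d) (R : realType) (P : probability Omega R).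
Context dT (T : measurableType dT) (n : nat) (X : 'I_n -> Omega -> T).
Variable q : set T -> \bar R.
Hypothesis mX : forall i, measurable_fun setT (X i).
Hypothesis XE : forall B : 'I_n -> set T, (forall i, measurable (B i)) ->
  P (\bigcap_i (X i @^-1` B i)) = (\big[*%E/1%E]_(i < n) q (B i))%E.

Definition pair_box (AB : 'I_n -> set T * set T) : set ('I_n -> T * T) :=
  [set z | forall i, (AB i).1 (z i).1 /\ (AB i).2 (z i).2].

Definition pair_boxes : set (set ('I_n -> T * T)) :=
  [set pair_box AB | AB in [set AB | forall i, measurable (AB i).1 /\ measurable (AB i).2]].

(** Boxes generate the sigma-algebra because independence determines the joint law exactly on
    them. *)
Definition ghost_space := g_sigma_algebraType pair_boxes.

Lemma measurable_ghost_fst i : measurable_fun setT (fun z : ghost_space => (z i).1).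
Proof.
move=> _ B mB; rewrite setTI; apply: sub_sigma_algebra.
exists (fun j => if j == i then (B, setT) else (setT, setT)).
  by move=> j /=; case: (j == i); split => //; exact: measurableT.
apply/seteqP; split=> z /= => [/(_ i)|Bz j]; first by rewrite eqxx => -[].
by case: eqP => [->|].
Qed.

Lemma measurable_ghost_snd i : measurable_fun setT (fun z : ghost_space => (z i).2).
Proof.
move=> _ B mB; rewrite setTI; apply: sub_sigma_algebra.
exists (fun j => if j == i then (setT, B) else (setT, setT)).
  by move=> j /=; case: (j == i); split => //; exact: measurableT.
apply/seteqP; split=> z /= => [/(_ i)|Bz j]; first by rewrite eqxx => -[].
by case: eqP => [->|].
Qed.

Definition ghost_pairs (s : {ffun 'I_n -> bool}) (p : Omega * Omega) : ghost_space :=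
  fun i => if s i then (X i p.2, X i p.1) else (X i p.1, X i p.2).

Lemma ghost_pairs_box s AB : ghost_pairs s @^-1` pair_box AB =
  (\bigcap_i X i @^-1` (if s i then (AB i).2 else (AB i).1)) `*`
  (\bigcap_i X i @^-1` (if s i then (AB i).1 else (AB i).2)).
Proof.
apply/seteqP; split=> -[w w'] /=.
  by move=> h; split=> i _ /=; have := h i; rewrite /ghost_pairs/=; case: (s i) => -[].
move=> [h1 h2] i; have := h1 i I; have := h2 i I.
by rewrite /ghost_pairs/=; case: (s i).
Qed.

Lemma measurable_bigcap_preimage (B : 'I_n -> set T) : (forall i, measurable (B i)) ->
  measurable (\bigcap_i X i @^-1` B i).
Proof.
move=> mB; apply: fin_bigcap_measurable => // i _; rewrite -[X in measurable X]setTI.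
exact: mX.
Qed.

Lemma measurable_ghost_pairs s : measurable_fun setT (ghost_pairs s).
Proof.
apply: (@measurability _ _ _ ghost_space setT (ghost_pairs s) pair_boxes) => //.
move=> _ [_ [AB mAB <-] <-]; rewrite setTI ghost_pairs_box; apply: measurableX.
  by apply: measurable_bigcap_preimage => i; case: (mAB i); case: (s i).
by apply: measurable_bigcap_preimage => i; case: (mAB i); case: (s i).
Qed.

Definition ghost_law s := mpush (prob_square P) (measurable_ghost_pairs s).

HB.instance Definition _ s := Probability.on (ghost_law s).

(** The mass of a box is a product of the symmetric factors [q (AB i).1 * q (AB i).2], and boxes
    form a pi-system. *)
Lemma ghost_law_swap s s' A : measurable A -> ghost_law s A = ghost_law s' A.
Proof.
move=> mA; apply: (@measure_unique _ _ ghost_space pair_boxes (fun=> setT)) => //.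
- move=> _ _ [AB mAB <-] [CE mCE <-].
  exists (fun i => ((AB i).1 `&` (CE i).1, (AB i).2 `&` (CE i).2)).
    move=> i /=; case: (mAB i) => ? ?; case: (mCE i) => ? ?.
    by split; exact: measurableI.
  apply/seteqP; split=> z /=; first by move=> h; split=> i; case: (h i) => -[? ?] [? ?].
  by move=> [h1 h2] i; case: (h1 i); case: (h2 i).
- move=> _; exists (fun=> (setT, setT)); last by apply/seteqP; split.
  by move=> i; split; exact: measurableT.
- by apply/seteqP; split=> // z _; exists 0%N.
- move=> _ [AB mAB <-].
  have E t : ghost_law t (pair_box AB) =
      (\big[*%E/1%E]_(i < n) (q (AB i).1 * q (AB i).2))%E.
    transitivity (prob_square P (ghost_pairs t @^-1` pair_box AB)) => //.
    rewrite ghost_pairs_box prob_squareX; last 2 first.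
      by apply: measurable_bigcap_preimage => i; case: (mAB i); case: (t i).
      by apply: measurable_bigcap_preimage => i; case: (mAB i); case: (t i).
    rewrite !XE; last 2 first.
      by move=> i; case: (mAB i); case: (t i).
      by move=> i; case: (mAB i); case: (t i).
    rewrite -big_split /=; apply: eq_bigr => i _; case: (t i) => //.
    exact: muleC.
  exact: (etrans (E s) (esym (E s'))).
- by move=> _; rewrite [X in (X < _)%E]probability_setT ltry.
Qed.

End ghost_sample.

(** * Symmetrization *)

Section symmetrization.
Context (R : realType) (D : nat).
Context d (Omega : measurableType d) (P : probability Omega R).
Context dT (T : measurableType dT) (n : nat) (X : 'I_n -> Omega -> T).
Variable q : set T -> \bar R.
Hypothesis mX : forall i, measurable_fun setT (X i).
Hypothesis XE : forall B : 'I_n -> set T, (forall i, measurable (B i)) ->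
  P (\bigcap_i (X i @^-1` B i)) = (\big[*%E/1%E]_(i < n) q (B i))%E.
Variables (g : 'rV[R]_D -> T -> R) (M : R).
Hypothesis mg : measurable_fun setT (fun p : borelRD R D * T => g p.1 p.2).
Hypothesis gM : forall x y, 0 <= g x y <= M.

Let ghost := @ghost_space _ T n.

Definition ghost_deviation (p : borelRD R D * ghost) : R :=
  `|\sum_i (g p.1 (p.2 i).1 - g p.1 (p.2 i).2)|.

Lemma measurable_ghost_deviation : measurable_fun setT ghost_deviation.
Proof.
apply: measurableT_comp => //; apply: measurable_sum => i.
have m1 : measurable_fun setT (fun p : borelRD R D * ghost => (p.1, (p.2 i).1)).
  by apply: measurable_fun_pair => //; exact: (measurableT_comp (measurable_ghost_fst i)).
have m2 : measurable_fun setT (fun p : borelRD R D * ghost => (p.1, (p.2 i).2)).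
  by apply: measurable_fun_pair => //; exact: (measurableT_comp (measurable_ghost_snd i)).
by apply: measurable_funB; [exact: (measurableT_comp mg m1)|exact: (measurableT_comp mg m2)].
Qed.

Lemma ghost_deviation_bound p : 0 <= ghost_deviation p <= n%:R * M.
Proof.
rewrite normr_ge0 /=; apply: le_trans (ler_norm_sum _ _ _) _.
rewrite mulr_natl -[in leRHS](card_ord n) -sumr_const; apply: ler_sum => i _.
have /andP[? ?] := gM p.1 (p.2 i).1; have /andP[? ?] := gM p.1 (p.2 i).2.
by rewrite ler_norml; apply/andP; split; lra.
Qed.

Lemma ghost_deviation_pairs s x w w' :
  ghost_deviation (x, ghost_pairs X s (w, w')) =
  `|signed_sum s (fun i => g x (X i w) - g x (X i w'))|.
Proof.
congr `|_|; apply: eq_bigr => i _; rewrite /ghost_pairs /=.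
by case: (s i); rewrite ?expr1 ?expr0 ?mul1r// mulN1r opprB.
Qed.

Lemma ghost_deviation_le_sup z x :
  ghost_deviation (x, z) <= sup (range (fun y => ghost_deviation (y, z))).
Proof.
apply: ub_le_sup; last by exists x.
by exists (n%:R * M) => _ [y _ <-]; case/andP: (ghost_deviation_bound (y, z)).
Qed.

Variables (Gm : 'rV[R]_D -> R) (c1 c2 p t : R).
Hypothesis GmE : forall x i, (\int[P]_w (g x (X i w))%:E = (Gm x)%:E)%E.
Hypothesis Gmp : forall x, Gm x <= p.
Hypothesis sign_average_bound : forall (z : 'I_n -> T * T) W,
  (forall x, \sum_i (g x (z i).1 + g x (z i).2) <= W) ->
  sign_average (fun s => sup (range (fun x : 'rV[R]_D =>
    `|signed_sum s (fun i => g x (z i).1 - g x (z i).2)|))) <= c1 + c2 * W.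
Hypotheses (c20 : 0 <= c2) (c24 : c2 <= 1 / 4) (t0 : 0 < t).

Let mgx x : measurable_fun setT (g x).
Proof. exact: (measurableT_comp mg (@pair1_measurable _ _ (borelRD R D) T x)). Qed.

Let mgX x i : measurable_fun setT (fun w => (g x (X i w))%:E).
Proof. by apply/measurable_EFinP; exact: (measurableT_comp (mgx x) (mX i)). Qed.

Let GmsumE x : (\int[P]_w (\sum_i g x (X i w))%:E = (n%:R * Gm x)%:E)%E.
Proof.
under eq_integral do rewrite -sumEFin.
rewrite ge0_integral_sum//; last by move=> i w _; rewrite lee_fin; case/andP: (gM x (X i w)).
under eq_bigr do rewrite GmE.
by rewrite sumEFin sumr_const card_ord mulr_natl.
Qed.

(** By Jensen the deviation at [w] is at most [hhat w], the ghost average of the supremum [h]. The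
    mean of [h] equals that of its sign average, which [sign_average_bound] controls by the
    deviations themselves; [c2 <= 1 / 4] absorbs them, and Markov's inequality gives the event. *)
Lemma symmetrized_deviation_bound : exists E, [/\ measurable E,
  ((1 - (2 * c1 + 4 * c2 * (n%:R * p)) / t)%:E <= P E)%E &
  forall w, E w -> forall x, `|\sum_i g x (X i w) - n%:R * Gm x| < t].
Proof.
pose s0 : {ffun 'I_n -> bool} := [ffun=> false].
pose law := ghost_law P mX s0.
have [h [N [mh h0M mN N0 hE]]] :=
  sup_ae_measurable law measurable_ghost_deviation ghost_deviation_bound.
have h0 z : 0 <= h z by case/andP: (h0M z).
have nM0 : 0 <= n%:R * M.
  by have /andP[] := ghost_deviation_bound (0, (fun=> point)); exact: le_trans.
pose H s (o : Omega * Omega) : R := h (ghost_pairs X s o).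
have H0 s o : 0 <= H s o by exact: h0.
have mH s : measurable_fun setT (H s).
  exact: (measurableT_comp mh (measurable_ghost_pairs mX s)).
have mHE s : measurable_fun setT (fun o => (H s o)%:E) by exact/measurable_EFinP.
pose hhatE w : \bar R := (\int[P]_w' (H s0 (w, w'))%:E)%E.
have hhatE0 w : (0 <= hhatE w)%E by apply: integral_ge0 => w' _; rewrite lee_fin.
have hhatEM w : (hhatE w <= (n%:R * M)%:E)%E.
  apply: (@le_trans _ _ (\int[P]_w' (cst (n%:R * M)%:E w'))%E).
    apply: ge0_le_integral => //.
    - by move=> w' _; rewrite lee_fin.
    - exact: (measurableT_comp (mHE s0) (pair1_measurable w)).
    - by move=> w' _; rewrite lee_fin; case/andP: (h0M (ghost_pairs X s0 (w, w'))).
  by rewrite integral_cst// [X in (_ * X <= _)%E]probability_setT mule1.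
pose hhat w := fine (hhatE w).
have hhatK w : (hhat w)%:E = hhatE w.
  rewrite fineK// ge0_fin_numE//; apply: le_lt_trans (hhatEM w) _; exact: ltry.
have hhat0 w : 0 <= hhat w by rewrite -lee_fin hhatK.
have mhhatE : measurable_fun setT hhatE.
  by apply: (measurable_fun_fubini_tonelli_F (fun o => (H s0 o)%:E)) => // o; rewrite lee_fin.
have mhhatE' : measurable_fun setT (fun w => (hhat w)%:E).
  by rewrite (_ : (fun w => _) = hhatE)//; apply/funext => w; rewrite hhatK.
have mhhat : measurable_fun setT hhat by exact/measurable_EFinP.
(* All exchanged laws coincide, so the exceptional set of [h] is null for every sign pattern. *)
have pullN s : prob_square P (ghost_pairs X s @^-1` N) = 0%E.
  rewrite -N0; exact: (@ghost_law_swap _ _ _ P _ T n X q mX XE s s0 N mN).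
have mpullN s : measurable (ghost_pairs X s @^-1` N).
  by rewrite -[X in measurable X]setTI; exact: measurable_ghost_pairs.
have dev_ae : {ae P, forall w, forall x, `|\sum_i g x (X i w) - n%:R * Gm x| <= hhat w}.
  have := prob_square_section_ae (mpullN s0) (pullN s0); apply: filterS => w sec0 x.
  pose Dv w' : R := `|\sum_i g x (X i w) - \sum_i g x (X i w')|.
  have mS : measurable_fun setT (fun w' => (\sum_i g x (X i w'))%:E).
    by apply/measurable_EFinP; apply: measurable_sum => i; apply/measurable_EFinP; exact: mgX.
  have mDv : measurable_fun setT (fun w' => (Dv w')%:E).
    apply/measurable_EFinP; apply: measurableT_comp => //; apply: measurable_funB => //.
    by apply/measurable_EFinP.
  have Dvh : (\int[P]_w' (Dv w')%:E <= (hhat w)%:E)%E.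
    rewrite hhatK; apply: ae_ge0_le_integral => //.
    - by move=> w' _; rewrite lee_fin normr_ge0.
    - by move=> w' _; rewrite lee_fin.
    - exact: (measurableT_comp (mHE s0) (pair1_measurable w)).
    exists (xsection (ghost_pairs X s0 @^-1` N) w); split => //.
      exact: measurable_xsection.
    move=> w' /= nle; rewrite /xsection /= inE; apply: contrapT => nN; apply: nle => _.
    rewrite lee_fin /H hE//; apply: le_trans (ghost_deviation_le_sup _ x).
    rewrite ghost_deviation_pairs /Dv /signed_sum -sumrB le_eqVlt; apply/orP; left; apply/eqP.
    by congr `|_|; apply: eq_bigr => i _; rewrite ffunE expr0 mul1r.
  have S0 w' : 0 <= \sum_i g x (X i w') by apply: sumr_ge0 => i _; case/andP: (gM x (X i w')).
  have Dv0 w' : 0 <= Dv w' by exact: normr_ge0.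
  have intD (c : R) : 0 <= c -> (\int[P]_w' ((Dv w')%:E + c%:E) = \int[P]_w' (Dv w')%:E + c%:E)%E.
    move=> c0; rewrite ge0_integralD//; last by move=> w' _; rewrite lee_fin.
    by rewrite -/(cst c%:E) integral_cst// [X in (_ * X)%E]probability_setT mule1.
  (* Jensen's inequality as two one-sided bounds between nonnegative integrals, which avoids
     integrating a difference. *)
  have le1 : ((n%:R * Gm x)%:E <= (hhat w)%:E + (\sum_i g x (X i w))%:E)%E.
    rewrite -GmsumE; apply: (le_trans _ (leeD2r _ Dvh)); rewrite -intD//.
    apply: ge0_le_integral => //.
    - by move=> w' _; rewrite lee_fin.
    - by apply: emeasurable_funD.
    - move=> w' _; rewrite -EFinD lee_fin /Dv -lerBlDr.
      by rewrite -normrN opprB; exact: ler_norm.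
  have le2 : ((\sum_i g x (X i w))%:E <= (hhat w)%:E + (n%:R * Gm x)%:E)%E.
    rewrite -GmsumE; apply: (le_trans _ (leeD2r _ Dvh)); rewrite -ge0_integralD//; last 2 first.
    - by move=> w' _; rewrite lee_fin.
    - by move=> w' _; rewrite lee_fin.
    rewrite (_ : (\sum_i g x (X i w))%:E = (\int[P]_w' cst (\sum_i g x (X i w))%:E w')%E); last first.
      by rewrite integral_cst// [X in (_ * X)%E]probability_setT mule1.
    apply: ge0_le_integral => //.
    - by move=> w' _; rewrite lee_fin.
    - by apply: emeasurable_funD.
    - by move=> w' _; rewrite -EFinD lee_fin /Dv -lerBlDr; exact: ler_norm.
  move: le1 le2; rewrite -!EFinD !lee_fin => le1 le2.
  by rewrite ler_norml; apply/andP; split; lra.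
pose HH : \bar R := (\int[P]_w (hhat w)%:E)%E.
have HHE s : (\int[prob_square P]_o (H s o)%:E = HH)%E.
  have EL s' : (\int[prob_square P]_o (H s' o)%:E = \int[ghost_law P mX s']_z (h z)%:E)%E.
    rewrite /ghost_law ge0_integral_mpush//; exact/measurable_EFinP.
  rewrite EL (_ : HH = \int[prob_square P]_o (H s0 o)%:E)%E.
    rewrite EL; apply: eq_measure_integral => A mA _.
    exact: (@ghost_law_swap _ _ _ P _ T n X q mX XE).
  rewrite integral_prob_square//; last by move=> o; rewrite lee_fin.
  by apply: eq_integral => w _; rewrite hhatK.
have HHfin : HH \is a fin_num.
  rewrite ge0_fin_numE; last by apply: integral_ge0 => w _; rewrite lee_fin.
  apply: (@le_lt_trans _ _ (\int[P]_w (cst (n%:R * M)%:E w))%E); last first.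
    by rewrite integral_cst// [X in (_ * X < _)%E]probability_setT mule1 ltry.
  apply: ge0_le_integral => //.
    by move=> w _; rewrite lee_fin.
  by move=> w _; rewrite hhatK.
have mav : measurable_fun setT (fun o => (sign_average (fun s => H s o))%:E).
  apply/measurable_EFinP; apply: measurable_funM => //.
  by apply: measurable_sum => s.
have av0 o : 0 <= sign_average (fun s => H s o).
  by rewrite mulr_ge0 ?invr_ge0 ?exprn_ge0// sumr_ge0.
have HHav : (HH = \int[prob_square P]_o (sign_average (fun s => H s o))%:E)%E.
  under eq_integral do rewrite /sign_average EFinM.
  rewrite ge0_integralZl//; last 2 first.
  - by apply/measurable_EFinP; apply: measurable_sum => s; exact: mH.
  - by move=> o _; rewrite lee_fin sumr_ge0.
  under eq_integral do rewrite -sumEFin.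
  rewrite ge0_integral_sum//; last by move=> s o _; rewrite lee_fin.
  under eq_bigr do rewrite HHE.
  rewrite -(fineK HHfin) sumEFin -EFinM; congr EFin.
  exact: (esym (@sign_average_cst R n (fine HH))).
have av_ae : {ae prob_square P, forall o, sign_average (fun s => H s o) <=
    c1 + c2 * (2 * (n%:R * p) + hhat o.1 + hhat o.2)}.
  have a1 := prob_square_fst_ae dev_ae; have a2 := prob_square_snd_ae dev_ae.
  have a3 : {ae prob_square P, forall o, forall s, ~ N (ghost_pairs X s o)}.
    apply: filter_forall => s; exists (ghost_pairs X s @^-1` N); split => //.
    by move=> o /= /contrapT.
  apply: filterS (filterI (filterI a1 a2) a3) => -[w w'] /= [[d1 d2] nN].
  (* Each of the two sums is at most its mean, bounded by [n%:R * p], plus its deviation. *)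
  have := sign_average_bound (z := fun i => (X i w, X i w')) (W := 2 * (n%:R * p) + hhat w + hhat w').
  rewrite (_ : (fun s => H s (w, w')) = fun s => sup (range (fun x : 'rV[R]_D =>
    `|signed_sum s (fun i => g x (X i w) - g x (X i w'))|))); last first.
    apply/funext => s; rewrite /H hE//; congr (sup (_ @` _)).
    by apply/funext => x; exact: ghost_deviation_pairs.
  apply=> x; rewrite big_split /=.
  have := d1 x; have := d2 x; rewrite !ler_norml => /andP[_ u2] /andP[_ u1].
  have : n%:R * Gm x <= n%:R * p by rewrite ler_wpM2l.
  lra.
have key : fine HH <= c1 + c2 * (2 * (n%:R * p) + fine HH + fine HH).
  have mf1 : measurable_fun setT (fun o : Omega * Omega => (hhat o.1)%:E).
    exact: (measurableT_comp mhhatE' measurable_fst).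
  have mf2 : measurable_fun setT (fun o : Omega * Omega => (hhat o.2)%:E).
    exact: (measurableT_comp mhhatE' measurable_snd).
  (* No sign is known for the constant term; adding [cc] to both sides makes both integrands
     nonnegative. *)
  pose c := `|c1 + c2 * (2 * (n%:R * p))|.
  pose cc := c - (c1 + c2 * (2 * (n%:R * p))).
  have cc0 : 0 <= cc by rewrite /cc subr_ge0; exact: ler_norm.
  have : (HH + cc%:E <= c2%:E * (HH + HH) + c%:E)%E.
    have i1 : (\int[prob_square P]_o (hhat o.1)%:E = HH)%E.
      by rewrite (integral_prob_square_fst _ mhhatE')// => w; rewrite lee_fin.
    have i2 : (\int[prob_square P]_o (hhat o.2)%:E = HH)%E.
      by rewrite (integral_prob_square_snd _ mhhatE')// => w; rewrite lee_fin.
    have ic (e : R) : (\int[prob_square P]_o (cst e%:E o) = e%:E)%E.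
      by rewrite integral_cst// [X in (_ * X)%E]probability_setT mule1.
    have h12 o : (0 <= (hhat o.1)%:E + (hhat o.2)%:E :> \bar R)%E by rewrite adde_ge0 ?lee_fin.
    have m12 := emeasurable_funD mf1 mf2.
    have e2 : (HH + HH = \int[prob_square P]_o ((hhat o.1)%:E + (hhat o.2)%:E))%E.
      by rewrite ge0_integralD ?i1 ?i2// => o _; rewrite lee_fin.
    have ec2 : (c2%:E * (HH + HH) =
        \int[prob_square P]_o (c2%:E * ((hhat o.1)%:E + (hhat o.2)%:E)))%E.
      by rewrite e2 ge0_integralZl.
    have h12c o : (0 <= c2%:E * ((hhat o.1)%:E + (hhat o.2)%:E) :> \bar R)%E.
      by apply: mule_ge0 (h12 o); rewrite lee_fin.
    have el : (HH + cc%:E = \int[prob_square P]_o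
        ((sign_average (fun s => H s o))%:E + cst cc%:E o))%E.
      rewrite HHav -[X in (_ + X)%E](ic cc) ge0_integralD// => o _; by rewrite lee_fin.
    have er : (c2%:E * (HH + HH) + c%:E = \int[prob_square P]_o
        (c2%:E * ((hhat o.1)%:E + (hhat o.2)%:E) + cst c%:E o))%E.
      rewrite ec2 -[X in (_ + X)%E](ic c) ge0_integralD// => [|o _].
        exact: measurable_funeM.
      by rewrite lee_fin normr_ge0.
    rewrite el er.
    apply: ae_ge0_le_integral => //.
    - by move=> o _; rewrite adde_ge0 ?lee_fin.
    - exact: emeasurable_funD.
    - by move=> o _; rewrite adde_ge0 ?mule_ge0 ?adde_ge0 ?lee_fin ?normr_ge0.
    - by apply: emeasurable_funD => //; apply: measurable_funeM; exact: emeasurable_funD.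
    apply: filterS av_ae => o le _.
    rewrite -[X in (X <= _)%E]/((sign_average (fun s => H s o) + cc)%:E).
    rewrite -[X in (_ <= X)%E]/((c2 * (hhat o.1 + hhat o.2) + c)%:E) lee_fin /cc.
    by move: le; lra.
  have [f fE] : exists f, HH = f%:E by exists (fine HH); rewrite fineK.
  rewrite fE -[X in (X <= _)%E]/((f + cc)%:E).
  rewrite -[X in (_ <= X)%E]/((c2 * (f + f) + c)%:E) lee_fin /cc /=; lra.
have HH0 : 0 <= fine HH by apply: fine_ge0; apply: integral_ge0 => w _; rewrite lee_fin.
have HHle : fine HH <= 2 * c1 + 4 * c2 * (n%:R * p).
  have : c2 * fine HH <= 1 / 4 * fine HH by rewrite ler_wpM2r.
  by move: key; lra.
have [N1 [mN1 N10 devN1]] := dev_ae.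
pose B := [set w | t <= hhat w].
have mB : measurable B.
  rewrite (_ : B = setT `&` hhat @^-1` `[t, +oo[%classic); first exact: mhhat.
  by rewrite setTI; apply/seteqP; split=> w /=; rewrite in_itv /= andbT.
(* Markov's inequality for [hhat]. *)
have PB : (P B <= (fine HH / t)%:E)%E.
  have : (t%:E * P B <= HH)%E.
    rewrite -(setIT B) -integral_indic// -ge0_integralZl//; last 2 first.
    - by apply/measurable_EFinP; exact: measurable_indic.
    - by rewrite lee_fin ltW.
    apply: ge0_le_integral => //.
    - by move=> w _; rewrite mule_ge0 ?lee_fin// ltW.
    - by apply: measurable_funeM; apply/measurable_EFinP; exact: measurable_indic.
    - move=> w _; rewrite -EFinM lee_fin indicE; case: (boolP (w \in B)); rewrite ?mulr0//= mulr1.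
      by rewrite inE.
  rewrite -(fineK HHfin) -(fineK (fin_num_measure P B mB)) -EFinM !lee_fin.
  by rewrite ler_pdivlMr// mulrC.
exists (~` (B `|` N1)); split.
- by apply: measurableC; exact: measurableU.
- have mBN : measurable (B `|` N1) by exact: measurableU.
  have PBN : (P (B `|` N1) <= (fine HH / t)%:E)%E.
    apply: le_trans (measureU2 _ _ _) _ => //.
    by rewrite [X in (_ + X <= _)%E]N10 adde0.
  have PBN' : fine (P (B `|` N1)) <= fine HH / t.
    by rewrite -lee_fin fineK// fin_num_measure.
  rewrite probability_setC// -(fineK (fin_num_measure P _ mBN)) -EFinB lee_fin.
  rewrite lerD2l lerN2; apply: le_trans PBN' _.
  by rewrite ler_wpM2r// invr_ge0 ltW.
- move=> w /not_orP[nB nN1] x.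
  have dv : forall x, `|\sum_i g x (X i w) - n%:R * Gm x| <= hhat w.
    by apply: contrapT => nd; apply: nN1; exact: devN1.
  by apply: le_lt_trans (dv x) _; rewrite ltNge; apply/negP.
Qed.

End symmetrization.

(** * Connected sets and paths *)

Section connected_paths.
Context (R : realType) (V : normedModType R).
Implicit Types (U C : set V) (a y z : V).

(* Paths are kept continuous on the whole real line so that a segment can be
   appended by a single formula. *)
Definition path_within U a y := exists g : R -> V,
  [/\ continuous g, g 0 = a, g 1 = y & forall t, 0 <= t <= 1 -> U (g t)].

Lemma path_within_segment U a y z : path_within U a y ->
  (forall t, 0 <= t <= 1 -> U (y + t *: (z - y))) -> path_within U a z.
Proof.
move=> [g [cg g0 g1 gU]] segU.
(* Clamping lets [g] run on the first half of the unit interval and the segment on the second. *)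
exists (fun t : R => g (Num.min (2 * t) 1) + Num.max (2 * t - 1) 0 *: (z - y)); split.
- move=> t; apply: cvgD.
    apply: (@cvg_comp _ _ _ (fun t : R => Num.min (2 * t) 1) g _ (nbhs (Num.min (2 * t) 1))); last exact: cg.
    apply: (@continuous_min _ _ (fun t : R => 2 * t) (fun=> 1)); last exact: cvg_cst.
    by apply: cvgM; [exact: cvg_cst|exact: cvg_id].
  apply: cvgZr_tmp.
  apply: (@continuous_max _ _ (fun t : R => 2 * t - 1) (fun=> 0)); last exact: cvg_cst.
  apply: cvgB; last exact: cvg_cst.
  by apply: cvgM; [exact: cvg_cst|exact: cvg_id].
- rewrite mulr0 min_l// max_r ?scale0r ?addr0//; lra.
- rewrite mulr1 min_r ?max_l; [|lra|lra].
  by rewrite (_ : 2 - 1 = 1 :> R); [rewrite scale1r g1 addrC subrK|lra].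
- move=> t /andP[t0 t1]; have [th|th] := leP t (1 / 2).
    rewrite min_l ?max_r ?scale0r ?addr0; [|lra|lra].
    by apply: gU; apply/andP; split; lra.
  rewrite min_r ?max_l ?g1; [|lra|lra].
  by apply: segU; apply/andP; split; lra.
Qed.

Lemma ball_segment y z e t : ball y e z -> 0 <= t <= 1 -> ball y e (y + t *: (z - y)).
Proof.
rewrite -ball_normE /ball_ /= => yz /andP[t0 t1].
rewrite opprD addNKr normrN normrZ ger0_norm//; apply: le_lt_trans yz.
by rewrite distrC ler_piMl.
Qed.

(** Balls are convex, so both the points reachable from [a] inside [U] and the unreachable ones form
    open sets; the reachable part of [C] is therefore open and closed in [C]. *)
Lemma connected_path_within U C a y : open U -> connected C -> C `<=` U -> C a -> C y ->
  path_within U a y.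
Proof.
rewrite openE => oU cC CU Ca Cy.
pose W := [set z | path_within U a z].
suff CW : C `&` W = C by move: Cy; rewrite -{1}CW => -[].
apply: cC.
- exists a; split => //; exists (cst a); split => //; first exact: cst_continuous.
  by move=> t _; exact: CU.
- exists W => //; rewrite openE => z pz.
  have Uz : U z by case: pz => g [_ _ <- gU]; apply: gU; rewrite ler01 lexx.
  have /nbhs_ballP[e /= e0 eU] := oU z Uz; apply/nbhs_ballP; exists e => //= z' zz'.
  apply: path_within_segment pz _ => t t01; apply: eU; exact: ball_segment.
- exists (~` (U `&` ~` W)); last first.
    apply/seteqP; split=> z [Cz hz]; split => //; first by move=> [_]; apply.
    by apply: contrapT => nW; apply: hz; split => //; exact: CU.
  apply: open_closedC; rewrite openE => z [Uz nW].
  have /nbhs_ballP[e /= e0 eU] := oU z Uz; apply/nbhs_ballP; exists e => //= z' zz'; split.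
    exact: eU.
  move=> pz'; apply: nW; apply: path_within_segment pz' _ => t t01; apply: eU.
  rewrite (_ : z' + t *: (z - z') = z + (1 - t) *: (z' - z)).
    by apply: ball_segment => //; move: t01 => /andP[? ?]; apply/andP; split; lra.
  rewrite -(opprB z' z) scalerN scalerBl scale1r addrCA addrA subrK addrC.
  by [].
Qed.

End connected_paths.

(** * Translates of a kernel *)

Section empirical_measure.
Context d (T : measurableType d) (R : realType) (N : nat) (y : nat -> T).

Lemma inv_succ_ge0 : 0 <= (N.+1%:R : R)^-1.
Proof. by rewrite invr_ge0. Qed.

Definition empirical : set T -> \bar R :=
  mscale (NngNum inv_succ_ge0) (msum (fun k => @dirac _ T (y k) R) N.+1).

HB.instance Definition _ := Measure.on empirical.

Let empirical_setT : empirical setT = 1%E.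
Proof.
rewrite /empirical /mscale /= /msum /=; under eq_bigr do rewrite diracT.
by rewrite sumEFin sumr_const card_ord -EFinM mulVf// pnatr_eq0.
Qed.

HB.instance Definition _ := Measure_isProbability.Build _ _ _ empirical empirical_setT.

Lemma integral_empirical (f : T -> R) : measurable_fun setT f -> (forall x, 0 <= f x) ->
  (\int[empirical]_x (f x)%:E = (N.+1%:R^-1 * \sum_(i < N.+1) f (y i))%:E)%E.
Proof.
move=> mf f0; have mfE : measurable_fun setT (EFin \o f) by exact/measurable_EFinP.
rewrite (@ge0_integral_mscale _ _ _ _ _ measurableT _ _ mfE); last first.
  by move=> x _; rewrite lee_fin.
rewrite ge0_integral_measure_sum//; last by move=> x _; rewrite lee_fin.
rewrite EFinM -sumEFin; congr (_ * _)%E; apply: eq_bigr => i _.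
by rewrite integral_dirac// diracT mul1e.
Qed.

End empirical_measure.

(** * Entropy of the translates along a double sample *)

Section kernel_translates.
Context (R : realType) (D : nat).
Variables (K : 'rV[R]_D -> R) (A v : R).
Hypothesis KA : kernel_assumption K A v.
Let M := sup (range K).

Lemma kernel_ge0 x : 0 <= K x.
Proof. by case: KA => _ [+ _] _ _ _; apply. Qed.

Lemma kernel_le_sup x : K x <= M.
Proof.
case: KA => _ [_ [m Km]] _ _ _; apply: ub_le_sup; last by exists x.
by exists m => _ [y _ <-].
Qed.

(** Every argument of [K] is reached by some translate at scale 1, so the envelope is constant. *)
Lemma kernel_envelopeE y : kernel_envelope K y = M.
Proof.
congr sup; apply/seteqP; split=> r /=; first by move=> [x [h [_ ->]]]; exists (h^-1 *: (x - y)).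
move=> [u _ <-]; exists (y + u), 1; split; first exact: ltr01.
by rewrite invr1 scale1r addrC addKr.
Qed.

Variables (sigma : R) (sigma0 : 0 < sigma).

Definition translate (x y : 'rV[R]_D) : R := K (sigma^-1 *: (x - y)).

Lemma measurable_translate :
  measurable_fun setT (fun p : borelRD R D * borelRD R D => translate p.1 p.2).
Proof.
case: KA => mK _ _ _ _; apply: (measurableT_comp mK).
apply/measurable_rVP => i; under eq_fun do rewrite scale_subE.
have /measurable_rVP h := @measurable_id _ (borelRD R D) setT.
apply: measurable_funM => //; apply: measurable_funB.
  exact: (measurableT_comp (h i) measurable_fst).
exact: (measurableT_comp (h i) measurable_snd).
Qed.

Lemma measurable_translate1 x : measurable_fun setT (translate x : borelRD R D -> R).
Proof.
exact: (measurableT_comp measurable_translate (@pair1_measurable _ _ (borelRD R D) (borelRD R D) x)).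
Qed.

(* The covering hypothesis, applied to the empirical measure of the 2n points. *)
Lemma empirical_cover (n : nat) (z : 'I_n.+1 -> borelRD R D * borelRD R D) (eta : R) :
  0 < eta < 1 -> exists (m : nat) (b : 'I_m -> 'I_n.+1 -> R), m%:R <= (A / eta) `^ v /\
    forall x, exists j, \sum_i ((translate x (z i).1 - translate x (z i).2) - b j i) ^+ 2
      <= 4 * n.+1%:R * M ^+ 2 * eta ^+ 2.
Proof.
move=> eta01.
(* Both components are interleaved, odd indices taking the first ones. As [empirical] averages one
   point more than its parameter, [n.*2.+1] gives all [2 * (n + 1)] points. *)
pose y (k : nat) : borelRD R D := let i := inord (k./2) : 'I_n.+1 in
  if odd k then (z i).1 else (z i).2.
have [mK _ _ _ cov] := KA.
have [m [c [mle [mc covc]]]] := cov (empirical R (n.*2.+1) y) eta eta01.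
exists m, (fun j i => c j (z i).1 - c j (z i).2); split=> // x.
have [j] := covc (translate x) (ex_intro _ x (ex_intro _ sigma (conj sigma0 erefl))).
under [X in (_ <= _ * X)%E -> _]eq_integral do rewrite kernel_envelopeE.
have mgc : measurable_fun setT (fun u : borelRD R D => (translate x u - c j u) ^+ 2).
  apply: (measurableT_comp (f := fun r : R => r ^+ 2)) => //.
  by apply: measurable_funB => //; exact: measurable_translate1.
rewrite integral_empirical//; last by move=> u; exact: sqr_ge0.
rewrite integral_empirical//; last by move=> u; exact: sqr_ge0.
rewrite sumr_const card_ord -[M ^+ 2 *+ _]mulr_natl mulKf ?pnatr_eq0//.
rewrite -EFinM lee_fin => le; exists j.
pose F u := (translate x u - c j u) ^+ 2.
have sumE : \sum_(k < n.*2.+2) F (y k) = \sum_i (F (z i).1 + F (z i).2).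
  rewrite -doubleS -(big_mkord xpredT (fun k => F (y k))).
  rewrite (_ : \sum_i _ = \sum_(0 <= i < n.+1) (F (z (inord i)).1 + F (z (inord i)).2)); last first.
    by rewrite big_mkord; apply: eq_bigr => i _; rewrite inord_val.
  elim: (n.+1) => [|k IH]; first by rewrite !big_nil.
  rewrite doubleS !big_nat_recr//= IH -addrA; congr (_ + _).
  by rewrite /y /= odd_double /= uphalf_double doubleK addrC.
apply: (@le_trans _ _ (\sum_i 2 * (F (z i).1 + F (z i).2))).
  apply: ler_sum => i _; rewrite /F.
  have : 0 <= ((translate x (z i).1 - c j (z i).1) + (translate x (z i).2 - c j (z i).2)) ^+ 2.
    exact: sqr_ge0.
  by lra.
rewrite -mulr_sumr -sumE.
move: le; rewrite ler_pdivrMl ?ltr0n// -/F => /(ler_wpM2l (ler0n R 2)) le2; apply: (le_trans le2).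
rewrite le_eqVlt; apply/orP; left; apply/eqP.
by rewrite -doubleS -mul2n natrM; ring.
Qed.

(** Chaining at the scales [eta * 2^-k]. The variance is bounded by [M * W], since squared
    differences of values in [[0, M]] are at most [M] times their sum. *)
Lemma sign_average_translate (n : nat) (z : 'I_n.+1 -> borelRD R D * borelRD R D)
    (eta kappa W : R) : 0 < eta < 1 -> 0 < kappa -> 0 < v ->
  (forall x, \sum_i (translate x (z i).1 + translate x (z i).2) <= W) ->
  sign_average (fun s => sup (range (fun x : 'rV[R]_D =>
    `|signed_sum s (fun i => translate x (z i).1 - translate x (z i).2)|))) <=
  36 * (kappa * (1 + 3 * (v * (ln (Num.max A 1 / eta) + ln 2))) +
    (M * W + 4 * n.+1%:R * M ^+ 2 * eta ^+ 2) / kappa).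
Proof.
move=> /[dup] eta01 /andP[eta0 eta1] k0 v0 hW.
(* Raising [A] to at least 1 keeps the logarithms nonnegative. *)
pose A' := Num.max A 1; pose G := v * (ln (A' / eta) + ln 2).
have A'1 : 1 <= A' by rewrite le_max lexx orbT.
have A'0 : 0 < A' := lt_le_trans ltr01 A'1.
have lnA : 0 <= ln (A' / eta).
  by apply: ln_ge0; rewrite ler_pdivlMr// mul1r (le_trans (ltW eta1)).
have ln20 : 0 <= ln 2 :> R by apply: ln_ge0; rewrite ler1n.
have G0 : 0 <= G by rewrite mulr_ge0 ?addr_ge0// ltW.
pose e k : R := eta * 2^-1 ^+ k.
have h0 k : 0 < (2^-1 : R) ^+ k by rewrite exprn_gt0// invr_gt0.
have e01 k : 0 < e k < 1.
  apply/andP; split; first exact: mulr_gt0.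
  apply: le_lt_trans eta1; rewrite /e ler_piMr ?(ltW eta0)//.
  by apply: exprn_ile1; lra.
have /choice[mb mbP] : forall k, exists mb : {m & 'I_m -> 'I_n.+1 -> R},
    (projT1 mb)%:R <= (A / e k) `^ v /\
    forall x, exists j, \sum_i ((translate x (z i).1 - translate x (z i).2) - projT2 mb j i) ^+ 2
      <= 4 * n.+1%:R * M ^+ 2 * e k ^+ 2.
  by move=> k; have [m [b mbP]] := empirical_cover z (e01 k); exists (existT _ m b).
have M0 : 0 <= M := le_trans (kernel_ge0 0) (kernel_le_sup 0).
have W0 : 0 <= W.
  by apply: le_trans (hW 0); apply: sumr_ge0 => i _; rewrite addr_ge0// kernel_ge0.
have mG k : (projT1 (mb k))%:R <= expR (k.+1%:R * G).
  have [le _] := mbP k; apply: le_trans le _.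
  have ek0 : 0 < e k by case/andP: (e01 k).
  apply: (@le_trans _ _ ((A' / e k) `^ v)).
    have [A0|A0] := leP 0 A.
      apply: ge0_ler_powR; [exact: ltW| | |].
      - by rewrite nnegrE divr_ge0// ltW.
      - by rewrite nnegrE divr_ge0// ltW.
      by rewrite ler_pM2r ?invr_gt0// le_max lexx.
    by case: KA => _ _ _ [_ [/ltW]]; rewrite leNgt A0.
  rewrite /powR gt_eqF ?divr_gt0// ler_expR /G mulrCA ler_wpM2l ?(ltW v0)//.
  rewrite /e invfM exprVn invrK mulrA lnM ?posrE ?divr_gt0// ?exprn_gt0//.
  rewrite lnXn// -[k.+1%:R]natr1 -[ln 2 *+ k]mulr_natl.
  have := mulr_ge0 (ler0n R k) lnA; lra.
(* In [1 + 3 * G], the 1 absorbs the factor 2, and the 3 comes from two consecutive covers: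
   [2 * k + 3 <= 3 * (k + 1)]. *)
have := @chaining R n.+1 _ (fun x i => translate x (z i).1 - translate x (z i).2)
  (fun s => sup (range (fun x : 'rV[R]_D =>
    `|signed_sum s (fun i => translate x (z i).1 - translate x (z i).2)|)))
  (M * W) (4 * n.+1%:R * M ^+ 2 * eta ^+ 2) kappa (1 + 3 * G) (fun k => projT1 (mb k))
  (fun k => projT2 (mb k)) k0.
apply.
- exact: mulr_ge0.
- by apply: mulr_ge0; [apply: mulr_ge0; [exact: mulr_ge0|exact: sqr_ge0]|exact: sqr_ge0].
- by rewrite addr_ge0// mulr_ge0.
- move=> x; apply: (@le_trans _ _ (\sum_i M * (translate x (z i).1 + translate x (z i).2))).
    apply: ler_sum => i _.
    have a0 := kernel_ge0 (sigma^-1 *: (x - (z i).1)); have aM := kernel_le_sup (sigma^-1 *: (x - (z i).1)).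
    have b0 := kernel_ge0 (sigma^-1 *: (x - (z i).2)); have bM := kernel_le_sup (sigma^-1 *: (x - (z i).2)).
    rewrite /translate; nra.
  by rewrite -mulr_sumr ler_wpM2l.
- move=> k x; have [_ /(_ x)[j le]] := mbP k; exists j; apply: le_trans le _.
  rewrite le_eqVlt; apply/orP; left; apply/eqP; rewrite /e exprMn -exprM mulnC exprM mulrA.
  by congr (_ * _ ^+ k); field.
- have h2 : 2 <= expR 1 :> R by apply: le_trans (expR_ge1Dx 1); lra.
  apply: (@le_trans _ _ (expR 1 * expR G)).
    by apply: ler_pM => //; have := mG 0%N; rewrite mul1r.
  by rewrite -expRD ler_expR; lra.
- move=> k; have h2 : 2 <= expR 1 :> R by apply: le_trans (expR_ge1Dx 1); lra.
  apply: (@le_trans _ _ (expR 1 * (expR (k.+1%:R * G) * expR (k.+2%:R * G)))).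
    by apply: ler_pM => //; apply: ler_pM.
  rewrite -!expRD ler_expR -[k.+2%:R]natr1 -[k.+1%:R]natr1.
  have := mulr_ge0 (ler0n R k) G0; have := ler0n R k; lra.
move=> s B hB; apply: ge_sup; first by exists (`|signed_sum s (fun i => translate 0 (z i).1 - translate 0 (z i).2)|), 0.
by move=> _ [x _ <-].
Qed.

End kernel_translates.

(** * The smoothed density *)

Section euclidean_norm.
Context (R : realType) (D : nat).
Implicit Types x y u : 'rV[R]_D.

Lemma sum_sqr_ge0 u : 0 <= \sum_(i < D) u ord0 i ^+ 2.
Proof. by apply: sumr_ge0 => i _; exact: sqr_ge0. Qed.

Lemma enorm_leP u (r : R) : 0 <= r ->
  (enorm u <= r) = (\sum_(i < D) u ord0 i ^+ 2 <= r ^+ 2).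
Proof.
move=> r0; apply/idP/idP => h.
  by rewrite -(sqr_sqrtr (sum_sqr_ge0 u)) lerXn2r// nnegrE// sqrtr_ge0.
by rewrite /enorm -[r]ger0_norm// -sqrtr_sqr ler_wsqrtr.
Qed.

Lemma enorm_sub_leP x y (r : R) : 0 <= r ->
  (enorm (x - y) <= r) = (\sum_(i < D) (x ord0 i - y ord0 i) ^+ 2 <= r ^+ 2).
Proof.
move=> r0; rewrite enorm_leP//; congr (_ <= _).
by apply: eq_bigr => i _; rewrite !mxE.
Qed.

Lemma continuous_sum_sqr y :
  continuous (fun x : 'rV[R]_D => \sum_(i < D) (y ord0 i - x ord0 i) ^+ 2).
Proof.
apply: continuous_big => [|i _ x]; first exact: add_continuous.
have sqr_cont (c : R) : continuous (fun r : R => (c - r) ^+ 2).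
  move=> r; apply: (@continuous_comp _ _ _ (fun r : R => c - r) (fun r : R => r ^+ 2)).
    by apply: cvgB; [exact: cvg_cst|exact: cvg_id].
  exact: exprn_continuous.
apply: (@continuous_comp _ _ _ (fun x : 'rV[R]_D => x ord0 i) (fun r => (y ord0 i - r) ^+ 2)).
  exact: coord_continuous.
exact: sqr_cont.
Qed.

(** The strict inequality is an open condition on the centre, so it passes from [x] to a nearby
    point of [S]. *)
Lemma fatten_closure (S : set 'rV[R]_D) (x y : 'rV[R]_D) (r : R) : 0 <= r ->
  closure S x -> \sum_(i < D) (y ord0 i - x ord0 i) ^+ 2 < r ^+ 2 -> fatten S r y.
Proof.
move=> r0 clSx yx.
have /clSx[s [Ss ys]] : nbhs x [set z : 'rV[R]_D | \sum_(i < D) (y ord0 i - z ord0 i) ^+ 2 < r ^+ 2].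
  apply: (continuous_sum_sqr (y := y) (x := x) (t := [set t | t < r ^+ 2])).
  by apply: open_nbhs_nbhs; split; [exact: open_lt|exact: yx].
by exists s => //; rewrite enorm_sub_leP// ltW.
Qed.

End euclidean_norm.

(** * Mean of the kernel estimator *)

Section smoothed_density.
Context (R : realType) (D : nat).
Variables (K : 'rV[R]_D -> R) (A v : R).
Hypothesis KA : kernel_assumption K A v.
Variables (f : 'rV[R]_D -> R) (fmax : R).
Hypotheses (fd : prob_density f) (ffmax : forall x, f x <= fmax).
Context d (Omega : measurableType d) (P : probability Omega R) (n : nat).
Variable X : 'I_n.+1 -> Omega -> 'rV[R]_D.
Hypothesis iid : iid_with_density P X f.
Variables (sigma : R) (sigma0 : 0 < sigma).

Implicit Types x y : 'rV[R]_D.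

Let leb := lebesgue_rV R D.

Let mX i : measurable_fun setT (X i : Omega -> borelRD R D).
Proof. by case: iid. Qed.

Let mf : measurable_fun setT (f : borelRD R D -> R). Proof. by case: fd. Qed.

Let f0 x : 0 <= f x. Proof. by case: fd => _ + _; apply. Qed.

Lemma density_iintE (B : set (borelRD R D)) : measurable B ->
  (iint (fun x => (f x)%:E * (\1_B x)%:E) = \int[leb]_x ((f x)%:E * (\1_B x)%:E))%E.
Proof.
move=> mB; rewrite -iintE//.
  by apply/measurable_EFinP/measurable_funM => //; exact: measurable_indic.
by move=> x; rewrite mule_ge0 ?lee_fin.
Qed.

Lemma marginal_density i (B : set (borelRD R D)) : measurable B ->
  mpush P (mX i) B = (\int[leb]_x ((f x)%:E * (\1_B x)%:E))%E.
Proof.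
move=> mB; rewrite -density_iintE//.
have [_ /(_ (fun j => if j == i then B else setT))] := iid.
rewrite (_ : \bigcap_j _ = X i @^-1` B); last first.
  apply/seteqP; split=> w /=; first by move=> /(_ i I); rewrite eqxx.
  by move=> Bw j _ /=; case: eqP => // ->.
rewrite (bigD1 i)//= eqxx big1 ?mule1 => [|j /negPf ji]; last first.
  rewrite ji; case: fd => _ _ <-; congr iint; apply/funext => x.
  by rewrite indicT mule1.
by apply=> j; case: ifP.
Qed.

Lemma integral_translate x : (\int[leb]_y (translate K sigma x y)%:E = (sigma ^+ D)%:E)%E.
Proof.
have [mK [K0 _] _ [K1 _] _] := KA.
rewrite -iintE; last 2 first.
- by apply/measurable_EFinP; exact: (measurable_translate1 KA).
- by move=> y; rewrite lee_fin; exact: (kernel_ge0 KA).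
rewrite (iint_affine sigma0 x (g := fun y => (K y)%:E)).
- by rewrite K1 mule1.
- exact/measurable_EFinP.
- by move=> y; rewrite lee_fin.
Qed.

Lemma translate_gt0 x y : 0 < translate K sigma x y -> enorm (x - y) <= sigma.
Proof.
have [_ _ K1 _ _] := KA; move=> /K1; rewrite enorm_leP// => h.
rewrite enorm_sub_leP ?(ltW sigma0)//; move: h; under eq_bigr do rewrite scale_subE exprMn.
by rewrite -mulr_sumr exprVn ler_pdivrMl ?exprn_gt0// expr1n mulr1.
Qed.

(** This is [sigma ^+ D] times the mean of the estimator; the first observation stands for all of
    them. *)
Definition smoothed (x : 'rV[R]_D) : R := fine (\int[P]_w (translate K sigma x (X ord0 w))%:E).

Lemma expectation_translateE x i :
  (\int[P]_w (translate K sigma x (X i w))%:E =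
   \int[mpush P (mX i)]_y (translate K sigma x y)%:E)%E.
Proof.
rewrite ge0_integral_mpush//.
  by apply/measurable_EFinP; exact: (measurable_translate1 KA).
by move=> y; rewrite lee_fin; exact: (kernel_ge0 KA).
Qed.

(** The translate lives on a closed ball whose bounding sphere is null, so a bound on [f] over the
    open ball suffices. This is what later admits the closure of the separator. *)
Lemma expectation_translate_le x i (c : R) : 0 <= c ->
  (forall y, \sum_(j < D) (x ord0 j - y ord0 j) ^+ 2 < sigma ^+ 2 -> f y <= c) ->
  (\int[P]_w (translate K sigma x (X i w))%:E <= (c * sigma ^+ D)%:E)%E.
Proof.
move=> c0 fc; rewrite expectation_translateE EFinM -(integral_translate x).
pose N := [set y : borelRD R D | \sum_(j < D) (x ord0 j - (y : 'rV[R]_D) ord0 j) ^+ 2 = sigma ^+ 2].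
have mS : measurable_fun setT (fun y : borelRD R D => \sum_(j < D) (x ord0 j - (y : 'rV[R]_D) ord0 j) ^+ 2).
  have /measurable_rVP h := @measurable_id _ (borelRD R D) setT.
  apply: measurable_sum => j; apply: (measurableT_comp (f := fun r : R => r ^+ 2)) => //.
  by apply: measurable_funB => //; exact: h.
have mN : measurable N.
  rewrite (_ : N = setT `&` (fun y : borelRD R D => \sum_(j < D) (x ord0 j - (y : 'rV[R]_D) ord0 j) ^+ 2) @^-1` [set sigma ^+ 2]).
    exact: mS.
  by rewrite setTI.
apply: (@integral_density_le _ _ _ leb (mpush P (mX i)) f mf f0 (@marginal_density i) c N) => //.
- rewrite -(setIT N) -integral_indic// -iintE.
  + by apply: iint_sphere => _; rewrite gt_eqF// exprn_gt0.
  + by apply/measurable_EFinP; exact: measurable_indic.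
  + by move=> y; rewrite lee_fin.
- exact: (measurable_translate1 KA).
- by move=> y; exact: (kernel_ge0 KA).
move=> y /translate_gt0; rewrite enorm_sub_leP ?(ltW sigma0)// le_eqVlt => /orP[/eqP e|lt] nN.
  by case: nN.
exact: fc.
Qed.

Lemma expectation_translate_ge x i (c : R) : 0 <= c ->
  (forall y, enorm (x - y) <= sigma -> c <= f y) ->
  ((c * sigma ^+ D)%:E <= \int[P]_w (translate K sigma x (X i w))%:E)%E.
Proof.
move=> c0 fc; rewrite expectation_translateE EFinM -(integral_translate x).
apply: (@integral_density_ge _ _ _ leb (mpush P (mX i)) f mf (@marginal_density i) c) => //.
- exact: (measurable_translate1 KA).
- by move=> y; exact: (kernel_ge0 KA).
by move=> y /translate_gt0; exact: fc.
Qed.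

Let fmax0 : 0 <= fmax. Proof. exact: le_trans (f0 0) (ffmax 0). Qed.

Lemma expectation_translate_smoothed x i :
  (\int[P]_w (translate K sigma x (X i w))%:E = (smoothed x)%:E)%E.
Proof.
have le := @expectation_translate_le x ord0 fmax fmax0 (fun y _ => ffmax y).
rewrite /smoothed fineK; last first.
  rewrite ge0_fin_numE; first by apply: le_lt_trans le _; exact: ltry.
  by apply: integral_ge0 => w _; rewrite lee_fin; exact: (kernel_ge0 KA).
rewrite !expectation_translateE; apply: eq_measure_integral => B mB _.
exact: (etrans (marginal_density _ mB) (esym (marginal_density _ mB))).
Qed.

End smoothed_density.

(** * Deviation of the kernel density estimator *)

Section kernel_deviation.
Context (R : realType) (D : nat).
Variables (K : 'rV[R]_D -> R) (A v : R).
Hypothesis KA : kernel_assumption K A v.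
Variables (f : 'rV[R]_D -> R) (fmax : R).
Hypotheses (fd : prob_density f) (ffmax : forall x, f x <= fmax).
Context d (Omega : measurableType d) (P : probability Omega R) (n : nat).
Variable X : 'I_n.+1 -> Omega -> 'rV[R]_D.
Hypothesis iid : iid_with_density P X f.
Variables (sigma : R) (sigma0 : 0 < sigma).

Let M := sup (range K).

(** The chaining bound is affine in [W] with slope [36 * M / kappa]; [144 * M <= kappa] makes this
    slope at most 1/4, as symmetrization requires. *)
Lemma kernel_deviation (eta kappa t : R) : 0 < eta < 1 -> 0 < kappa -> 144 * M <= kappa ->
  0 < t -> exists E, [/\ measurable E,
  ((1 - (72 * (kappa * (1 + 3 * (v * (ln (Num.max A 1 / eta) + ln 2))) +
         4 * n.+1%:R * M ^+ 2 * eta ^+ 2 / kappa) +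
       144 * M / kappa * (n.+1%:R * (fmax * sigma ^+ D))) / t)%:E <= P E)%E &
  forall w, E w -> forall x, `|\sum_i translate K sigma x (X i w) -
    n.+1%:R * smoothed K P X sigma x| < t].
Proof.
move=> eta01 k0 Mk t0.
have [_ _ _ [_ [_ v0]] _] := KA.
have M0 : 0 <= M := le_trans (kernel_ge0 KA 0) (kernel_le_sup KA 0).
have fmax0 : 0 <= fmax by case: fd => _ /(_ 0) f0 _; exact: le_trans f0 (ffmax 0).
pose L := 1 + 3 * (v * (ln (Num.max A 1 / eta) + ln 2)).
pose B2 := 4 * n.+1%:R * M ^+ 2 * eta ^+ 2.
have [mX indep] := iid.
have := @symmetrized_deviation_bound R D _ Omega P _ (borelRD R D) n.+1 X
  (fun B => iint (fun x => (f x)%:E * (\1_B x)%:E)%E) mX indep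
  (translate K sigma) M (measurable_translate KA sigma)
  (fun x y => introT andP (conj (kernel_ge0 KA _) (kernel_le_sup KA _)))
  (smoothed K P X sigma) (36 * (kappa * L + B2 / kappa)) (36 * M / kappa)
  (fmax * sigma ^+ D) t
  (expectation_translate_smoothed KA fd ffmax iid sigma0).
case.
- move=> x; rewrite -lee_fin -(expectation_translate_smoothed KA fd ffmax iid sigma0 x ord0).
  by apply: (expectation_translate_le KA fd iid sigma0) => // y _; exact: ffmax.
- move=> z W hW.
  have := sign_average_translate KA sigma0 eta01 k0 v0 hW; rewrite -/M -/L -/B2.
  by move=> /le_trans; apply; rewrite le_eqVlt; apply/orP; left; apply/eqP; field; rewrite gt_eqF.
- by rewrite divr_ge0 ?mulr_ge0// ltW.
- rewrite ler_pdivrMr//; lra.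
- exact: t0.
move=> E [mE PE hE]; exists E; split => //.
rewrite (_ : 72 * _ + _ = 2 * (36 * (kappa * L + B2 / kappa)) +
  4 * (36 * M / kappa) * (n.+1%:R * (fmax * sigma ^+ D)))//.
by rewrite /B2 /L; field; rewrite gt_eqF.
Qed.

End kernel_deviation.

(** * From uniform deviation to separated components *)

Section cluster_separation.
Context (R : realType) (D : nat).
Variables (K : 'rV[R]_D -> R) (A v : R).
Hypothesis KA : kernel_assumption K A v.
Variables (f : 'rV[R]_D -> R) (fmax : R).
Hypotheses (fd : prob_density f) (ffmax : forall x, f x <= fmax).
Context d (Omega : measurableType d) (P : probability Omega R) (n : nat).
Variable X : 'I_n.+1 -> Omega -> 'rV[R]_D.
Hypothesis iid : iid_with_density P X f.
Variables (sigma eps lambda : R).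
Hypotheses (sigma0 : 0 < sigma) (lambda0 : 0 < lambda).
Variable w : Omega.
Hypothesis dev : forall x, `|\sum_i translate K sigma x (X i w) -
    n.+1%:R * smoothed K P X sigma x| < n.+1%:R * (sigma ^+ D * lambda * eps / 2).

Let L := [set x | lambda * (1 - eps / 2) <= kde K sigma (fun i => X i w) x].

Lemma kde_deviation x :
  `|kde K sigma (fun i => X i w) x - smoothed K P X sigma x / sigma ^+ D| < lambda * eps / 2.
Proof.
have N0 : 0 < n.+1%:R :> R by rewrite ltr0n.
have s0 : 0 < sigma ^+ D by rewrite exprn_gt0.
have Ns0 : 0 < n.+1%:R * sigma ^+ D by exact: mulr_gt0.
rewrite (_ : _ - _ = (n.+1%:R * sigma ^+ D)^-1 * (\sum_i translate K sigma x (X i w) -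
    n.+1%:R * smoothed K P X sigma x)); last first.
  by rewrite /kde -/(translate _ _ _ _); field; rewrite !gt_eqF.
rewrite normrM gtr0_norm ?invr_gt0// ltr_pdivrMl//.
by apply: lt_le_trans (dev x) _; rewrite le_eqVlt; apply/orP; left; apply/eqP; field.
Qed.

Lemma smoothed_ge (x : 'rV[R]_D) (c : R) : 0 <= c -> (forall y, enorm (x - y) <= sigma -> c <= f y) ->
  c * sigma ^+ D <= smoothed K P X sigma x.
Proof.
move=> c0 fc; rewrite -lee_fin -(expectation_translate_smoothed KA fd ffmax iid sigma0 x ord0).
exact: (expectation_translate_ge KA fd iid sigma0).
Qed.

Lemma smoothed_le (x : 'rV[R]_D) (c : R) : 0 <= c ->
  (forall y : 'rV[R]_D, \sum_(j < D) (x ord0 j - y ord0 j) ^+ 2 < sigma ^+ 2 -> f y <= c) ->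
  smoothed K P X sigma x <= c * sigma ^+ D.
Proof.
move=> c0 fc; rewrite -lee_fin -(expectation_translate_smoothed KA fd ffmax iid sigma0 x ord0).
exact: (expectation_translate_le KA fd iid sigma0).
Qed.

Lemma high_density_sub_level (B : set 'rV[R]_D) :
  (forall x, fatten B sigma x -> lambda <= f x) -> B `<=` L.
Proof.
move=> fB x Bx; rewrite /L /=.
have s0 : 0 < sigma ^+ D by rewrite exprn_gt0.
have : lambda * sigma ^+ D <= smoothed K P X sigma x.
  apply: smoothed_ge => [|y xy]; first exact: ltW.
  apply: fB; exists x => //; move: xy; rewrite !enorm_sub_leP ?(ltW sigma0)//.
  by under eq_bigr do rewrite -sqrrN opprB.
rewrite -ler_pdivlMr// => le; have := kde_deviation x.
rewrite ltr_norml => /andP[l _]; lra.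
Qed.

(** Near a point of the closure [f] stays below [(1 - eps) * lambda], hence so does the mean; the
    deviation adds less than [lambda * eps / 2]. *)
Lemma separator_closure_not_level (S : set 'rV[R]_D) (x : 'rV[R]_D) :
  sup (f @` fatten S sigma) < (1 - eps) * lambda -> closure S x -> ~ L x.
Proof.
move=> supS Sx; rewrite /L /=; apply/negP; rewrite -ltNge.
have s0 : 0 < sigma ^+ D by rewrite exprn_gt0.
pose c := sup (f @` fatten S sigma).
have fc y : fatten S sigma y -> f y <= c.
  by move=> Sy; apply: ub_le_sup; [exists fmax => _ [z _ <-]|exists y].
have near_fatten (y : 'rV[R]_D) : \sum_(j < D) (x ord0 j - y ord0 j) ^+ 2 < sigma ^+ 2 -> fatten S sigma y.
  move=> xy; apply: (fatten_closure (x := x)) => //; first exact: ltW.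
  by under eq_bigr do rewrite -sqrrN opprB.
have c0 : 0 <= c.
  case: fd => _ /(_ x) f0 _; apply: le_trans f0 (fc _ _); apply: near_fatten.
  by rewrite big1 ?exprn_gt0// => i _; rewrite subrr expr0n.
have : smoothed K P X sigma x <= c * sigma ^+ D.
  by apply: smoothed_le => // y /near_fatten /fc.
rewrite -ler_pdivrMr// => le; have := kde_deviation x; move: supS; rewrite -/c => supS.
rewrite ltr_norml => /andP[_ l]; lra.
Qed.

(** A connected part of [L] meeting both clusters avoids [closure S], so a path joins them in the
    open complement, whereas every such path must meet [S]. *)
Lemma separated_clusters_separated (A1 A2 : set 'rV[R]_D) :
  separated_clusters f sigma eps lambda A1 A2 ->
  [/\ A1 `<=` L, A2 `<=` L &
    forall a1 a2, A1 a1 -> A2 a2 -> ~ connected_component L a1 a2].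
Proof.
move=> [_ _ fA [S [_ pathS supS]]]; split.
- by apply: high_density_sub_level => x A1x; apply: fA; left.
- by apply: high_density_sub_level => x A2x; apply: fA; right.
move=> a1 a2 A1a A2a [C [Ca1 CL cC] Ca2].
have CU : C `<=` ~` closure S.
  by move=> x /CL Lx Sx; exact: separator_closure_not_level supS Sx Lx.
have [g [cg g0 g1 gU]] := connected_path_within (closed_openC (@closed_closure _ S)) cC CU Ca1 Ca2.
have [|t t01 Sgt] := pathS g a1 a2 A1a A2a.
  by split=> //; exact: continuous_subspaceT.
by apply: (gU t t01); exact: subset_closure.
Qed.

End cluster_separation.

(** * Choice of the constants and conclusion *)

Theorem mainTheorem13 (R : realType) (D : nat) (A v kinf k2 fmax delta : R) :
  0 < delta < 1 ->
  exists (C h0 : R) (n0 : nat), 0 < C /\ 0 < h0 /\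
  forall K : 'rV[R]_D -> R,
    kernel_assumption K A v ->
    sup (range K) = kinf ->
    0 <= k2 -> iint (fun x => ((K x) ^+ 2)%:E) = (k2 ^+ 2)%:E ->
  forall f : 'rV[R]_D -> R,
    prob_density f -> (forall x, f x <= fmax) ->
  forall (sigma eps lambda : R) (n : nat),
    0 < sigma <= h0 -> 0 < eps < 1 -> 0 < lambda ->
    (n0 <= n)%N ->
    C / (sigma ^+ D * lambda ^+ 2 * eps ^+ 2) * ln (sigma^-1) <= n%:R ->
  forall (d : measure_display) (Omega : measurableType d)
         (P : probability Omega R) (X : 'I_n -> Omega -> 'rV[R]_D),
    iid_with_density P X f ->
    exists E : set Omega, measurable E /\ ((1 - delta)%:E <= P E)%E /\
      forall omega, E omega ->
      forall A1 A2 : set 'rV[R]_D,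
        separated_clusters f sigma eps lambda A1 A2 ->
        let L := [set x | lambda * (1 - eps / 2) <=
                          kde K sigma (fun i => X i omega) x] in
        A1 `<=` L /\ A2 `<=` L /\
        (forall a1 a2, A1 a1 -> A2 a2 -> ~ connected_component L a1 a2).
Proof.
move=> /andP[delta0 delta1].
pose A' := Num.max A 1.
(* [cL] times [ln (sigma^-1)] will dominate the entropy at scale [sigma ^+ D.+1]. Absolute values
   appear since the signs of the parameters are not yet known. *)
pose cL := 1 + 3 * (`|v| * (ln A' + D.+1%:R + ln 2)).
pose q := 288 * kinf ^+ 2 + 144 * `|kinf| * `|fmax|.
pose k0 := 1 + 4 * q / delta + 144 * `|kinf| * `|fmax|.
have A'1 : 1 <= A' by rewrite le_max lexx orbT.
have A'0 : 0 < A' := lt_le_trans ltr01 A'1.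
have ln20 : 0 <= ln 2 :> R by apply: ln_ge0; rewrite ler1n.
have cL1 : 1 <= cL by rewrite lerDl !mulr_ge0// !addr_ge0// ln_ge0.
have kf0 : 0 <= 144 * `|kinf| * `|fmax| by rewrite !mulr_ge0.
have q0 : 0 <= q by exact: addr_ge0 (mulr_ge0 (ler0n R 288) (sqr_ge0 _)) kf0.
have qd0 : 0 <= 4 * q / delta by rewrite divr_ge0 ?mulr_ge0// ltW.
have k01 : 1 <= k0 by rewrite /k0; lra.
have k0p : 0 < k0 := lt_le_trans ltr01 k01.
have cLp : 0 < cL := lt_le_trans ltr01 cL1.
(* [h0 = expR (- 1)] ensures [ln (sigma^-1) >= 1], [n0 = 1] excludes the empty sample, and 288 is 4
   times the 72 of the deviation bound. *)
exists (288 * k0 * cL / delta), (expR (- 1)), 1%N; split.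
  exact: divr_gt0 (mulr_gt0 (mulr_gt0 (ltr0Sn R 287) k0p) cLp) delta0.
split; first exact: expR_gt0.
move=> K KA Kinf _ _ f fd ffmax sigma eps lambda n /andP[s0 sh] /andP[eps0 eps1] l0.
case: n => // n _ nC d Omega P X iid.
(* If [lambda] exceeds [fmax], clusters at that level are empty and any event works. *)
have [lf|fl] := leP lambda fmax; last first.
  exists setT; split; first exact: measurableT.
  split; first by rewrite probability_setT lee_fin gerBl ltW.
  move=> w _ A1 A2 [_ _ fA _].
  have empty B x : (forall y, fatten B sigma y -> lambda <= f y) -> ~ B x.
    move=> fB Bx; suff : lambda <= fmax by rewrite leNgt fl.
    apply: le_trans (ffmax x); apply: fB; exists x => //.
    rewrite enorm_sub_leP ?(ltW s0)// big1 ?sqr_ge0// => i _.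
    by rewrite subrr expr0n.
  have e1 x : ~ A1 x by apply: empty => y A1y; apply: fA; left.
  have e2 x : ~ A2 x by apply: empty => y A2y; apply: fA; right.
  by split; [move=> x /e1|split; [move=> x /e2|move=> a1 a2 /e1]].
have fmax0 : 0 < fmax := lt_le_trans l0 lf.
have kinf0 : 0 <= kinf by rewrite -Kinf; exact: le_trans (kernel_ge0 KA 0) (kernel_le_sup KA 0).
have v0 : 0 < v by case: KA => _ _ _ [_ []].
pose l := ln (sigma^-1).
have l1 : 1 <= l.
  rewrite /l -[leLHS]expRK ler_ln ?posrE ?expR_gt0 ?invr_gt0//.
  by rewrite -[expR 1]invrK -expRN lef_pV2 ?posrE ?expR_gt0.
have sigma1 : sigma < 1.
  by apply: le_lt_trans sh _; rewrite -[ltRHS]expR0 ltr_expR oppr_lt0 ltr01.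
(* The exponent [D.+1] gives [eta ^+ 2 <= sigma ^+ D] and keeps [eta < 1] even for [D = 0]. *)
pose eta := sigma ^+ D.+1.
have eta0 : 0 < eta by rewrite exprn_gt0.
have eta1 : eta < 1 by rewrite exprn_ilt1// ltW.
have sD0 : 0 < sigma ^+ D by rewrite exprn_gt0.
have eta2 : eta ^+ 2 <= sigma ^+ D.
  rewrite /eta -exprM ler_wiXn2l ?(ltW s0) ?(ltW sigma1)//.
  by rewrite (leq_trans (leqnSn D))// leq_pmulr.
(* With this choice the entropy term and the variance term both become comparable to [delta * t]:
   [p1] and [p2] give each at most half of it. *)
pose kappa := k0 / (lambda * eps).
have le0 : 0 < lambda * eps by exact: mulr_gt0.
have kap0 : 0 < kappa by rewrite divr_gt0.
have lef : lambda * eps <= fmax.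
  by apply: le_trans lf; rewrite ler_piMr// ltW.
have Mk : 144 * sup (range K) <= kappa.
  rewrite Kinf ler_pdivlMr//.
  apply: (@le_trans _ _ (144 * kinf * fmax)).
    by rewrite ler_wpM2l// mulr_ge0.
  by rewrite /k0 !ger0_norm ?(ltW fmax0)//; lra.
pose N : R := n.+1%:R.
have N0 : 0 < N by rewrite ltr0n.
pose t := N * (sigma ^+ D * lambda * eps / 2).
have t0 : 0 < t by rewrite mulr_gt0// divr_gt0// !mulr_gt0.
have [E [mE PE devE]] := kernel_deviation KA fd ffmax iid s0 (introT andP (conj eta0 eta1)) kap0 Mk t0.
exists E; split => //; split; last first.
  move=> w Ew A1 A2 sep L.
  by have [] := separated_clusters_separated KA fd ffmax iid s0 l0 (devE w Ew) sep.
apply: le_trans PE; rewrite lee_fin lerD2l lerN2 ler_pdivrMr// Kinf.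
pose LL := 1 + 3 * (v * (ln (A' / eta) + ln 2)); rewrite -/A' -/LL -/N.
have lnA' : 0 <= ln A' by exact: ln_ge0.
have LLle : LL <= cL * l.
  rewrite /LL lnM ?posrE ?invr_gt0// /eta -exprVn lnXn ?invr_gt0// -/l.
  rewrite -[l *+ D.+1]mulr_natr /cL gtr0_norm// [l * _]mulrC.
  have : v * (ln A' + D.+1%:R * l + ln 2) <= v * (ln A' + D.+1%:R + ln 2) * l.
    rewrite -mulrA ler_wpM2l ?(ltW v0)//.
    have := ler_wpM2l lnA' l1; have := ler_wpM2l ln20 l1; lra.
  lra.
have nC' : 288 * k0 * (cL * l) <= N * (delta * (sigma ^+ D * (lambda * eps) ^+ 2)).
  move: nC; rewrite -/l -/N mulrAC ler_pdivrMr; last by rewrite !mulr_gt0 ?exprn_gt0.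
  rewrite mulrAC ler_pdivrMr// => h; apply: le_trans (le_trans _ h) _; first by rewrite mulrA.
  by rewrite le_eqVlt; apply/orP; left; apply/eqP; ring.
have p1 : 72 * (kappa * LL) <= delta * (N * (sigma ^+ D * (lambda * eps))) / 4.
  have -> : 72 * (kappa * LL) = 288 * k0 * LL / (4 * (lambda * eps)).
    by rewrite /kappa; field; rewrite !gt_eqF.
  rewrite ler_pdivrMr ?mulr_gt0//.
  apply: (@le_trans _ _ (288 * k0 * (cL * l))); first by apply: ler_wpM2l LLle; exact: mulr_ge0 (ler0n R 288) (ltW k0p).
  by apply: le_trans nC' _; rewrite le_eqVlt; apply/orP; left; apply/eqP; field.
have p2 : 72 * (4 * N * kinf ^+ 2 * eta ^+ 2 / kappa) + 144 * kinf / kappa * (N * (fmax * sigma ^+ D))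
    <= delta * (N * (sigma ^+ D * (lambda * eps))) / 4.
  apply: (@le_trans _ _ (q * (N * sigma ^+ D) / kappa)).
    rewrite ler_pdivlMr// (_ : _ * kappa = 288 * kinf ^+ 2 * N * eta ^+ 2 + 144 * kinf * fmax * (N * sigma ^+ D)); last first.
      by field; rewrite gt_eqF.
    rewrite /q (ger0_norm kinf0) (gtr0_norm fmax0).
    have := ler_wpM2l (mulr_ge0 (sqr_ge0 kinf) (ltW N0)) eta2; lra.
  rewrite ler_pdivrMr// /kappa.
  have -> : delta * (N * (sigma ^+ D * (lambda * eps))) / 4 * (k0 / (lambda * eps)) =
      delta * k0 / 4 * (N * sigma ^+ D) by field; rewrite !gt_eqF.
  apply: ler_wpM2r; first by rewrite mulr_ge0// ltW.
  have : 4 * q / delta <= k0 by rewrite /k0; lra.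
  by rewrite ler_pdivrMr// => ?; lra.
rewrite mulrDr -addrA; apply: (le_trans (lerD p1 p2)).
by rewrite /t le_eqVlt; apply/orP; left; apply/eqP; field.
Qed.
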